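(* Let $V:P(\mathbb{R}^d)\to\mathbb{R}\cup\{\infty\}$ be any function such that $V(\delta_x)=0$ for every Dirac mass $\delta_x$, $x\in\mathbb{R}^d$. Then $V=Var$ if and only if for any measurable space $Z$ and any $\rho(x,z)=\rho(x|z)\nu(z)\in P(\mathbb{R}^d\times Z)$, with $\mathbb{R}^d$-marginal $\rho(x)$, there exists a Wasserstein barycenter $\mu$ of $\rho(x,z)$ that satisfies $$V(\rho(x)) - V(\mu) = \int_Z W_2^2(\rho(\cdot|z),\mu)\, d\nu(z),$$ where, when infinite values occur, the identity is read as $V(\rho(x)) = V(\mu) + \int_Z W_2^2(\rho(\cdot|z),\mu)\, d\nu(z)$ in $\mathbb{R}\cup\{\infty\}$.
   Context: $P(\cdot)$ denotes probability measures (Borel in the $\mathbb{R}^d$ variable). $\nu$ is the $Z$-marginal of $\rho(x,z)$ and $\rho(\cdot|z)\in P(\mathbb{R}^d)$ are the conditional distributions obtained by disintegration. $W_2$ is the 2-Wasserstein distance: $W_2^2(\alpha,\beta)=\inf_\pi\int\|x-y\|^2d\pi(x,y)\in[0,\infty]$ over couplings $\pi$ of $\alpha,\beta\in P(\mathbb{R}^d)$. A Wasserstein barycenter of $\rho(x,z)$ is a $\mu\in P(\mathbb{R}^d)$ attaining $\inf_{\mu'\in P(\mathbb{R}^d)}\int_Z W_2^2(\rho(\cdot|z),\mu')\,d\nu(z)$. For $\eta\in P(\mathbb{R}^d)$ with finite second moment and mean $\overline{x}$, $Var(\eta)=\int\|x-\overline{x}\|^2d\eta(x)$; $Var(\eta)=\infty$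 if the second moment is infinite. *)

(* Defs.v *)
From HB Require Import structures.
From mathcomp Require Import all_boot all_order all_algebra.
From mathcomp Require Import all_classical all_reals all_analysis.

Set Implicit Arguments.
Unset Strict Implicit.
Unset Printing Implicit Defensive.
Import Order.TTheory GRing.Theory Num.Theory.
Import numFieldNormedType.Exports.

Local Open Scope classical_set_scope.
Local Open Scope ring_scope.
Local Open Scope ereal_scope.

Definition Rd (R : realType) (d : nat) : measurableType (@open 'rV[R]_d).-sigma :=
  g_sigma_algebraType (@open 'rV[R]_d).

(* The library norm on 'rV[R]_d is the sup norm, so the Euclidean one is spelled
   out (the topology, hence the Borel sigma-algebra, is the same). *)
Definition sqnorm (R : realType) (d : nat) (x : 'rV[R]_d) : R :=
  (\sum_(i < d) x ord0 i ^+ 2)%R.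

(* A library measure is a function on all subsets, constrained only on the
   measurable ones.  Elements of P(T) are therefore compared on measurable sets,
   and a function on P(T) must not see the values on non-measurable sets. *)
Definition eq_proba (R : realType) d (T : measurableType d)
    (mu nu : probability T R) : Prop :=
  forall A, measurable A -> mu A = nu A.

Definition well_defined (R : realType) d (T : measurableType d)
    (V : probability T R -> \bar R) : Prop :=
  forall mu nu, eq_proba mu nu -> V mu = V nu.

Section marginals.
Context (R : realType) d1 d2 (X : measurableType d1) (Z : measurableType d2).

HB.instance Definition _ :=
  isMeasurableFun.Build _ _ _ _ (@fst X Z) measurable_fst.
HB.instance Definition _ :=
  isMeasurableFun.Build _ _ _ _ (@snd X Z) measurable_snd.

Definition marginal1 (rho : probability (X * Z)%type R) : probability X R :=
  distribution rho (@fst X Z).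

Definition marginal2 (rho : probability (X * Z)%type R) : probability Z R :=
  distribution rho (@snd X Z).

(* rho(x, z) = rho(x | z) nu(z), with nu the Z-marginal of rho and
   k z = rho(. | z).  [pprobability X R] is [probability X R] with the
   sigma-algebra generated by the evaluations mu |-> mu A, A measurable. *)
Definition disintegration (rho : probability (X * Z)%type R)
    (k : Z -> pprobability X R) : Prop :=
  measurable_fun [set: Z] k /\
  forall A B, measurable A -> measurable B ->
    rho (A `*` B) = \int[marginal2 rho]_(z in B) k z A.

End marginals.

Section wasserstein.
Context (R : realType) (d : nat).

Definition coupling (a b : probability (Rd R d) R)
    (p : probability (Rd R d * Rd R d)%type R) : Prop :=
  eq_proba (marginal1 p) a /\ eq_proba (marginal2 p) b.

Definition W2sq (a b : probability (Rd R d) R) : \bar R :=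
  ereal_inf [set \int[p]_xy (sqnorm (xy.1 - xy.2)%R)%:E | p in coupling a b].

Definition mean (eta : probability (Rd R d) R) : 'rV[R]_d :=
  (\row_i \int[eta]_x (x : 'rV[R]_d) ord0 i)%R.

Definition Var (eta : probability (Rd R d) R) : \bar R :=
  if \int[eta]_x (sqnorm x)%:E < +oo
  then \int[eta]_x (sqnorm ((x : 'rV[R]_d) - mean eta)%R)%:E
  else +oo.

Definition barycenter dZ (Z : measurableType dZ) (nu : probability Z R)
    (k : Z -> probability (Rd R d) R) (mu : probability (Rd R d) R) : Prop :=
  \int[nu]_z W2sq (k z) mu =
  ereal_inf [set \int[nu]_z W2sq (k z) mu'
            | mu' in [set: probability (Rd R d) R]].

End wasserstein.

(* Main.v *)
(* Dirac kernels force V = Var: for rho the diagonal coupling of eta, the cost of mu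
   is the integral of |x - y|^2 against eta x mu, which is minimal exactly at the
   Dirac mass at the mean of eta, with value Var eta (or is always infinite).

   Conversely, a minimizing sequence mu_n has W_2^2(rho(.|z0), mu_n) bounded along
   a subsequence for some z0, hence is tight; W_2^2(rho(.|z), .) is lower
   semicontinuous, so Fatou's lemma in z makes a limit point a barycenter.  The
   decomposition is a first-order condition: for every coupling of rho(.|z) and mu,
   replacing mu by its image under y |-> a + c (y - a) changes the cost by a quantity
   that depends only on the second moments about a and on the cost itself.
   Minimality at c = 1 therefore gives M_a(rho) = M_a(mu) + cost for every point a,
   M_a denoting the second moment about a, and Var is the minimum of M_a over a. *)
Require Import Defs.
From HB Require Import structures.
From mathcomp Require Import all_boot all_order all_algebra.
From mathcomp Require Import all_classical all_reals all_analysis.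
From mathcomp Require Import measurable_realfun giry ring lra.

Set Implicit Arguments.
Unset Strict Implicit.
Unset Printing Implicit Defensive.
Import Order.TTheory GRing.Theory Num.Theory.
Import numFieldNormedType.Exports.

Local Open Scope classical_set_scope.
Local Open Scope ring_scope.
Local Open Scope ereal_scope.

(** * Borel sets of Rd *)

(** Weak convergence is tested on countably many functions [test j] only, continuous minorants of
    orthant indicators. This countability writes the sublevel sets of [W2sq] as countable
    intersections, and so makes z |-> W_2^2(rho(.|z), mu) measurable, which Fatou's lemma requires.

    The limit measures behind tightness are constructed explicitly. A pair of points is encoded by
    its binary answers to countably many tests [c i t <= q]. After extraction the masses of all
    finite words converge, and the limit masses subdivide the unit interval; Lebesgue measure,
    pushed forward by the decoding of nested words, is the limit. Applied to couplings with a fixed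
    first marginal and bounded cost, this one construction yields the optimal couplings that the
    dilation argument uses, the limits of minimizing sequences and the semicontinuity of the cost.

    If the infimum is infinite, every measure is a barycenter. Compactness thus serves only when the
    infimum is finite, a case that includes some rho with infinite second moment. *)

Lemma countType_bigcup_measurable dT (T : measurableType dT) (I : countType)
    (D : set I) (F : I -> set T) :
  (forall i, D i -> measurable (F i)) -> measurable (\bigcup_(i in D) F i).
Proof.
move=> mF; rewrite bigcup_mkcond.
apply: countable_bigcupT_measurable => [|i]; first exact: countableP.
by case: ifPn => // /set_mem; exact: mF.
Qed.

Section borel_Rd.
Context (R : realType) (d : nat).

Lemma measurable_coord (i : 'I_d) :
  measurable_fun [set: Rd R d] (fun x : Rd R d => (x : 'rV[R]_d) ord0 i).
Proof.
apply: (measurability _ (RGenOInfty.measurableE R)) => //.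
move=> _ [_ [a ->] <-]; rewrite setTI.
apply: sub_sigma_algebra.
apply: open_comp; last exact: interval_open.
by move=> x _; exact: (@coord_continuous R 1 d ord0 i).
Qed.

Let box (pq : {ffun 'I_d -> rat} * {ffun 'I_d -> rat}) : set 'rV[R]_d :=
  [set x | forall i, (ratr (pq.1 i) < x ord0 i < ratr (pq.2 i))%R].

Let open_box (G : set 'rV[R]_d) : open G ->
  G = \bigcup_(pq in [set pq | box pq `<=` G]) box pq.
Proof.
move=> oG; apply/seteqP; split => [x Gx|x [pq pqG pqx]]; last exact: pqG.
have /nbhs_ballP[e /= e0 xeG] : nbhs x G by exact: open_nbhs_nbhs.
have exp i : exists q : rat, (x ord0 i - e < ratr q < x ord0 i)%R.
  have [q] := @rat_in_itvoo R (x ord0 i - e) (x ord0 i) ltac:(by rewrite ltrBlDr ltrDl).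
  by rewrite in_itv/=; exists q.
have exq i : exists q : rat, (x ord0 i < ratr q < x ord0 i + e)%R.
  have [q] := @rat_in_itvoo R (x ord0 i) (x ord0 i + e) ltac:(by rewrite ltrDl).
  by rewrite in_itv/=; exists q.
pose p := [ffun i => xchoose (exp i)].
pose q := [ffun i => xchoose (exq i)].
exists (p, q) => /= [y pqy|i]; last first.
  by rewrite !ffunE; have /andP[_ ->] := xchooseP (exp i); have /andP[-> _] := xchooseP (exq i).
apply: xeG; split => // i j; rewrite (ord1 i).
have := pqy j; rewrite /= !ffunE => /andP[py yq].
have /andP[h1 _] := xchooseP (exp j); have /andP[_ h2] := xchooseP (exq j).
rewrite /ball/= ltr_distlC (lt_trans h1 py)/=.
exact: lt_trans yq h2.
Qed.

(** Balls of the sup norm are boxes, so every open set is a countable union of boxes with rational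
    corners, and preimages of boxes only involve coordinates. *)
Lemma measurable_fun_coord dT (T : measurableType dT) (f : T -> Rd R d) :
  (forall i, measurable_fun [set: T] (fun t => (f t : 'rV[R]_d) ord0 i)) ->
  measurable_fun [set: T] f.
Proof.
move=> mf; apply: (@measurability _ _ T (Rd R d) setT f (@open 'rV[R]_d)) => //.
move=> _ [G oG <-]; rewrite setTI (open_box oG) preimage_bigcup.
apply: countType_bigcup_measurable => pq _.
have -> : f @^-1` box pq = \bigcap_(i in [set: 'I_d])
    ((fun t => (f t : 'rV[R]_d) ord0 i) @^-1` `](ratr (pq.1 i) : R), ratr (pq.2 i)[).
  apply/seteqP; split => [t /= bt i _|t /= bt i]; first by rewrite /= in_itv/=; exact: bt.
  by have := bt i I; rewrite /= in_itv.
apply: fin_bigcap_measurable => // i _.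
by rewrite -[X in measurable X]setTI; apply: mf => //; exact: measurable_itv.
Qed.

(** The masses of these sets are the values of the distribution function at rational points. Strict
    inequalities make the indicators increasing limits of continuous functions, see
    [test_orthant]. *)
Definition orthant (q : {ffun 'I_d -> rat}) : set (Rd R d) :=
  [set x | forall i, ((x : 'rV[R]_d) ord0 i < ratr (q i))%R].

Lemma measurable_orthant q : measurable (orthant q).
Proof.
have -> : orthant q = \bigcap_(i in [set: 'I_d])
    ((fun x : Rd R d => (x : 'rV[R]_d) ord0 i) @^-1` `]-oo, ratr (q i)[).
  apply/seteqP; split => [t /= bt i _|t /= bt i]; first by rewrite /= in_itv/=; exact: bt.
  by have := bt i I; rewrite /= in_itv.
apply: fin_bigcap_measurable => // i _.
rewrite -[X in measurable X]setTI; apply: (measurable_coord i) => //; exact: measurable_itv.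
Qed.

Let orthants : set (set (Rd R d)) := [set setT] `|` range orthant.

(** A half-space [x ord0 i < a] is a countable union of orthants: the i-th entry of the corner stays
    below [a], the others are free. *)
Let measurable_orthants : @measurable _ (Rd R d) = <<s orthants >>.
Proof.
apply/seteqP; split => A mA.
- have mid : measurable_fun [set: g_sigma_algebraType orthants]
      (id : g_sigma_algebraType orthants -> Rd R d).
    apply: measurable_fun_coord => i.
    apply: (measurability _ (RGenInftyO.measurableE R)) => //.
    move=> _ [_ [a ->] <-]; rewrite setTI.
    have -> : (fun x : 'rV[R]_d => x ord0 i) @^-1` `]-oo, a[ =
        \bigcup_(q in [set q : {ffun 'I_d -> rat} | (ratr (q i) <= a)%R]) orthant q.
      apply/seteqP; split => [x /=|x [q /= qa xq]]; rewrite in_itv/=.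
        move=> xa.
        have exq j : exists q : rat, (x ord0 j < ratr q)%R /\ (j = i -> ratr q <= a)%R.
          have [->|ji] := eqVneq j i.
            have [q] := @rat_in_itvoo R _ _ xa.
            by rewrite in_itv/= => /andP[? ?]; exists q; split => // _; exact: ltW.
          have [q] := @rat_in_itvoo R (x ord0 j) (x ord0 j + 1)%R ltac:(by rewrite ltrDl).
          by rewrite in_itv/= => /andP[? ?]; exists q; split => // E; rewrite E eqxx in ji.
        have [q hq] := choice exq.
        exists [ffun j => q j] => /= [|j]; rewrite ffunE; first by apply: (hq i).2.
        exact: (hq j).1.
      exact: lt_le_trans (xq i) qa.
    apply: countType_bigcup_measurable => q _.
    by apply: sub_sigma_algebra; right; exists q.
  by have := mid measurableT A mA; rewrite setTI.
- move: mA; apply: smallest_sub; first exact: sigma_algebra_measurable.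
  move=> _ [->|[q _ <-]] //; exact: measurable_orthant.
Qed.

Lemma eq_proba_orthant (a b : probability (Rd R d) R) :
  (forall q, a (orthant q) = b (orthant q)) -> eq_proba a b.
Proof.
move=> ab A mA.
apply: (measure_unique orthants (fun=> setT)) => //.
- move=> _ _ [->|[p _ <-]] [->|[q _ <-]].
  + by left; rewrite setTI.
  + by right; exists q; rewrite // setTI.
  + by right; exists p; rewrite // setIT.
  + right; exists [ffun i => Num.min (p i) (q i)] => //; apply/seteqP; split => x /=.
      move=> xpq; split => i; have := xpq i; rewrite ffunE => /lt_le_trans; apply;
      by rewrite ler_rat ge_min lexx ?orbT.
    by move=> [xp xq] i; rewrite ffunE; case: (leP (p i) (q i)) => _; [exact: xp|exact: xq].
- by left.
- by rewrite bigcup_const.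
- by move=> _ [->|[q _ <-]]; [exact: etrans (probability_setT a) (esym (probability_setT b))|exact: ab].
- by move=> _; rewrite (le_lt_trans (probability_le1 _ _)) ?ltry.
Qed.

End borel_Rd.

(** * Countable compactness and finite-valued functions *)

(** Tychonoff's theorem gives a cluster point [p]. Since [I] is countable, the neighbourhoods of [p]
    fixing the first l indices up to 1/(l+1) form a sequence, and each of them meets the tail of [a]
    after l. The extraction [s] need not be monotone: [n <= s n] is enough for limits. *)
Lemma countable_subsequence (R : realType) (I : countType) (a : nat -> I -> R) :
  (forall n i, (0 <= a n i <= 1)%R) ->
  exists (s : nat -> nat) (p : I -> R),
    (forall n, (n <= s n)%N) /\ forall i, a (s n) i @[n --> \oo] --> p i.
Proof.
move=> a01.
have cK : @compact (prod_topology (fun _ : I => R))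
    [set f | forall i, `[0%R, 1%R]%classic (f i)].
  by apply: (@tychonoff I (fun=> R) (fun=> `[0%R, 1%R]%classic)) => i; exact: segment_compact.
pose F : set_system (prod_topology (fun _ : I => R)) := a @ \oo.
have FF : ProperFilter F by exact: fmap_proper_filter.
have FK : F [set f | forall i, `[0%R, 1%R]%classic (f i)].
  by exists 0%N => // n _ i; rewrite /= in_itv/=; exact: a01.
have [p [_ clp]] := cK F FF FK.
pose G : set_system (prod_topology (fun _ : I => R)) := nbhs p.
have FG : Filter G by exact: nbhs_filter.
have Gj (j : I) (e : R) : (0 < e)%R -> G [set f : I -> R | (`|p j - f j| < e)%R].
  move=> e0; apply: (@proj_continuous I (fun=> R) j p [set y | (`|p j - y| < e)%R]).
  by apply: nbhsx_ballx.
have near_p l (e : R) : (0 < e)%R ->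
    G [set f | forall i, (pickle i < l)%N -> (`|p i - f i| < e)%R].
  rewrite -/G; clearbody G; move=> e0; elim: l => [|l IH].
    by rewrite (_ : [set f | _] = setT); [exact: filterT|apply/seteqP].
  case E : (@pickle_inv I l) => [j|].
    apply: filterS (filterI IH (Gj j e e0)) => f [fl fj] i; rewrite ltnS leq_eqVlt.
    move=> /orP[/eqP il|]; last exact: fl.
    have := @pickle_invK I l; rewrite E/= -il => /(pcan_inj pickleK) <-.
    exact: fj.
  apply: filterS IH => f fl i; rewrite ltnS leq_eqVlt => /orP[/eqP il|]; last exact: fl.
  by move: E; rewrite -il pickleK_inv.
have exs l : exists n, (l <= n)%N /\
    forall i, (pickle i < l)%N -> (`|p i - a n i| < l.+1%:R^-1)%R.
  have Fl : F [set f | exists2 n, (l <= n)%N & f = a n].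
    by exists l => //= n ln; exists n.
  have [_ [[n ln ->] h]] := clp _ _ Fl (near_p l l.+1%:R^-1%R ltac:(by rewrite invr_gt0 ltr0n)).
  by exists n.
have [s hs] := choice exs.
exists s, p; split => [n|i]; first exact: (hs n).1.
apply/cvgrPdist_lt => e e0.
near=> n.
apply: (lt_trans ((hs n).2 i _)); first by near: n; exact: nbhs_infty_gt.
by near: n; exact: near_infty_natSinv_lt (PosNum e0).
Unshelve. all: by end_near. Qed.

Lemma integral_cst_proba (R : realType) dT (T : measurableType dT)
    (m : probability T R) (r : \bar R) : \int[m]_t r = r.
Proof.
have := integral_cst m measurableT r; rewrite /cst => ->.
by rewrite [X in _ * X](_ : _ = 1) ?mule1//; exact: probability_setT.
Qed.

Lemma integral_fin_fun (R : realType) dT (T : measurableType dT)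
    (m : {measure set T -> \bar R}) (F : finType) (h : T -> F) (g : F -> R) :
  (forall w, measurable (h @^-1` [set w])) -> (forall w, 0 <= g w)%R ->
  \int[m]_t (g (h t))%:E = \sum_(w : F) (g w)%:E * m (h @^-1` [set w]).
Proof.
move=> mh g0.
under eq_integral => t _.
  rewrite (_ : (g (h t))%:E = \sum_(w : F) (g w * \1_(h @^-1` [set w]) t)%:E).
    over.
  rewrite sumEFin (bigD1 (h t))//= indicE mem_set// mulr1 big1 ?addr0// => w wt.
  by rewrite indicE memNset ?mulr0// => /= E; rewrite E eqxx in wt.
rewrite ge0_integral_sum//; first last.
- by move=> w t _; rewrite lee_fin mulr_ge0.
- by move=> w; apply/measurable_EFinP; apply: measurable_funM => //; exact: measurable_indic.
apply: eq_bigr => w _; under eq_integral do rewrite EFinM.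
rewrite ge0_integralZl//; last first.
- by rewrite lee_fin.
- by apply/measurable_EFinP; exact: measurable_indic.
by rewrite integral_indic ?setIT.
Qed.

Lemma measurable_fin_fun (R : realType) dT (T : measurableType dT)
    (F : finType) (h : T -> F) (g : F -> R) :
  (forall w, measurable (h @^-1` [set w])) -> measurable_fun [set: T] (fun t => g (h t)).
Proof.
move=> mh _ A mA; rewrite setTI.
have -> : (fun t => g (h t)) @^-1` A = \bigcup_(w in [set w | A (g w)]) (h @^-1` [set w]).
  by apply/seteqP; split => [t At|t [w /= Aw ->]//]; exists (h t).
exact: countType_bigcup_measurable.
Qed.

Section unit_interval.
Context (R : realType).

(** The sample space remains the whole line, whose points outside [0, 1[ form a null set. The
    interval is half-open like those attached to the words below. *)
Definition unit_leb : set _ -> \bar R :=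
  mrestr (@lebesgue_measure R) (measurable_itv `[0%R, 1%R[).

HB.instance Definition _ := Measure.on unit_leb.

Let unit_leb_setT : unit_leb setT = 1.
Proof. by rewrite /unit_leb/= /mrestr setTI lebesgue_measure_itv/= lte01 oppr0 adde0. Qed.

HB.instance Definition _ := @Measure_isProbability.Build _ _ R unit_leb unit_leb_setT.

End unit_interval.

(** * Nested subdivisions of the unit interval *)

Section nested_intervals.
Context (R : realType) (p : seq bool -> R).
Hypothesis p_nil : p [::] = 1%R.
Hypothesis p_ge0 : forall w, (0 <= p w)%R.
Hypothesis p_rcons : forall w, p w = (p (rcons w false) + p (rcons w true))%R.

(* [p w] is the length of the interval attached to the word [w]; the intervals of
   [rcons w false] and [rcons w true] partition that of [w], and [interval_code u n] is
   the word of length [n] whose interval contains [u], with its left end. *)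
Fixpoint interval_code (u : R) (n : nat) : seq bool * R :=
  if n is m.+1 then
    let: (w, l) := interval_code u m in
    if (l + p (rcons w false) <= u)%R then (rcons w true, l + p (rcons w false))%R
    else (rcons w false, l)
  else ([::], 0%R).

Lemma size_interval_code u n : size (interval_code u n).1 == n.
Proof.
elim: n => //= n; case: (interval_code u n) => w l /= /eqP wn.
by case: ifPn => _; rewrite size_rcons wn.
Qed.

Definition interval_code_tuple u n : n.-tuple bool := Tuple (size_interval_code u n).

(** Each digit [true], at position k, steps over the interval of the left sibling
    [rcons (take k w) false]. *)
Definition left_end (w : seq bool) : R :=
  \sum_(k < size w | nth false w k) p (rcons (take k w) false).

Lemma left_end_rcons w b :
  left_end (rcons w b) = (left_end w + (if b then p (rcons w false) else 0))%R.
Proof.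
rewrite /left_end size_rcons big_mkcond big_ord_recr/= nth_rcons ltnn eqxx.
rewrite -cats1 take_size_cat// cats1; congr (_ + _)%R.
rewrite [RHS]big_mkcond/=; apply: eq_bigr => k _.
by rewrite nth_rcons ltn_ord -[rcons w b]cats1 takel_cat// ltnW.
Qed.

Lemma interval_code_left_end u n : (interval_code u n).2 = left_end (interval_code u n).1.
Proof.
elim: n => [|n] /=; first by rewrite /left_end big_ord0.
by case: (interval_code u n) => w l /= ->; case: ifPn => _; rewrite left_end_rcons/= ?addr0.
Qed.

Lemma interval_code_itv u n : (0 <= u < 1)%R ->
  (left_end (interval_code u n).1 <= u < left_end (interval_code u n).1 + p (interval_code u n).1)%R.
Proof.
move=> u01; elim: n => [|n] /=.
  by rewrite /left_end big_ord0 p_nil add0r.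
rewrite -interval_code_left_end; case E : (interval_code u n) => [w l] /= /andP[lu ul].
have := interval_code_left_end u n; rewrite E/= => lw.
case: ifPn => h /=; rewrite left_end_rcons/= ?addr0 -lw.
- by rewrite h/= -addrA -p_rcons.
- by rewrite lu/= ltNge.
Qed.

(** With [interval_code_itv], this identifies the fibre of [w] inside the unit interval with the
    half-open interval of [w], which is empty when [p w] vanishes. *)
Lemma interval_codeE u w : (left_end w <= u < left_end w + p w)%R -> (interval_code u (size w)).1 = w.
Proof.
elim/last_ind: w => [|w b IH] //; rewrite left_end_rcons size_rcons => /andP[lu ul].
have {IH} : (interval_code u (size w)).1 = w.
  apply: IH; apply/andP; split.
    by apply: le_trans lu; rewrite lerDl; case: ifP => _; [exact: p_ge0|exact: lexx].
  apply: (lt_le_trans ul); rewrite -addrA lerD2l (p_rcons w).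
  by case: b {lu ul} => /=; [exact: lexx|rewrite add0r lerDl; exact: p_ge0].
have := interval_code_left_end u (size w).
case E : (interval_code u (size w)) => [w' l] /= lE ww'; rewrite E/= lE ww'.
case: b lu ul; rewrite ?addr0 => lu ul; first by rewrite lu.
by rewrite leNgt ul.
Qed.

(** Outside the unit interval codes exist too, constantly [false] on the left and [true] on the
    right, so the fibre is not the interval of [w]. Induction on the word avoids the distinction:
    each digit compares [u] with one threshold. *)
Lemma measurable_interval_code n (w : n.-tuple bool) :
  measurable ((fun u => interval_code_tuple u n) @^-1` [set w]).
Proof.
have -> : (fun u => interval_code_tuple u n) @^-1` [set w] = [set u | (interval_code u n).1 = w :> seq bool].
  by apply/seteqP; split => u /= => [<-//|h]; apply/val_inj.
case: w => w /= /eqP; elim/last_ind: w n => [|w b IH] n.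
  move=> <-; rewrite (_ : [set u | _] = setT)//.
  by apply/seteqP; split.
rewrite size_rcons => <-.
pose a := (left_end w + p (rcons w false))%R.
have -> : [set u | (interval_code u (size w).+1).1 = rcons w b] =
    [set u | (interval_code u (size w)).1 = w] `&` [set u | (a <= u)%R = b].
  apply/seteqP; split => u /=;
    have := interval_code_left_end u (size w); case E : (interval_code u (size w)) => [w' l] /= ->.
  + by case: ifPn => h /= /rcons_inj[ww bb]; split; rewrite // -bb /a -ww ?h ?(negbTE h).
  + by move=> [-> <-]; rewrite -/a; case: ifPn.
apply: measurableI; first exact: IH.
case: b {IH}.
  rewrite (_ : [set u | _] = `[a, +oo[%classic); first exact: measurable_itv.
  by apply/seteqP; split => u /=; rewrite in_itv/= andbT.
rewrite (_ : [set u | _] = `]-oo, a[%classic); first exact: measurable_itv.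
by apply/seteqP; split => u /=; rewrite in_itv/= ltNge; [move=> -> | move/negbTE].
Qed.

Lemma left_end_bounds w : (0 <= left_end w /\ left_end w + p w <= 1)%R.
Proof.
elim/last_ind: w => [|w b [IH1 IH2]].
  by rewrite /left_end big_ord0 p_nil add0r.
rewrite left_end_rcons; split; first by rewrite addr_ge0//; case: b => //; exact: p_ge0.
apply: le_trans IH2; rewrite -addrA lerD2l (p_rcons w).
by case: b => /=; [exact: lexx|rewrite add0r lerDl; exact: p_ge0].
Qed.

Lemma unit_leb_interval_code n (w : n.-tuple bool) :
  unit_leb ((fun u => interval_code_tuple u n) @^-1` [set w]) = (p w)%:E.
Proof.
rewrite /unit_leb/= /mrestr.
rewrite (_ : _ `&` _ = `[left_end w, (left_end w + p w)%R[%classic); last first.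
  apply/seteqP; split => u /=; rewrite !in_itv/=.
    by move=> [<- u01]; exact: interval_code_itv.
  move=> h; split; last first.
    have [l0 l1] := left_end_bounds w; move: h => /andP[lu ul].
    by rewrite (le_trans l0 lu) (lt_le_trans ul l1).
  by apply/val_inj => /=; have := interval_codeE h; rewrite size_tuple.
rewrite lebesgue_measure_itv/= lte_fin ltrDl; have [->|pw] := eqVneq (p w) 0%R.
  by rewrite ltxx.
by rewrite lt_neqAle eq_sym pw p_ge0 -EFinD addrAC subrr add0r.
Qed.

Lemma interval_code_prefix u m n : (m <= n)%N -> (interval_code u m).1 = take m (interval_code u n).1.
Proof.
move=> /subnK <-; elim: (n - m)%N => [|k IH].
  by rewrite add0n -{2}(eqP (size_interval_code u m)) take_size.
rewrite {}IH addSn/=.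
have := size_interval_code u (k + m).
case: (interval_code u (k + m)) => w l /= /eqP wk.
by case: ifPn => _ /=; rewrite -cats1 takel_cat// wk leq_addl.
Qed.

End nested_intervals.

(** * A Helly selection theorem *)

Lemma limn_einf_le (R : realType) (u : (\bar R)^nat) (K : R) :
  (forall e N, (0 < e)%R -> exists2 n, (N <= n)%N & u n <= (K + e)%:E) ->
  limn_einf u <= K%:E.
Proof.
move=> h; rewrite limn_einf_lim; apply: lime_le; first exact: is_cvg_einfs.
apply: nearW => N; apply/lee_addgt0Pr => e e0.
have [n Nn un] := h e N e0.
by apply: le_trans un; apply: ereal_inf_lbound; exists n.
Qed.

Lemma measurable_limn_einf (R : realType) dT (T : measurableType dT)
    (F : (T -> \bar R)^nat) :
  (forall n, measurable_fun [set: T] (F n)) ->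
  measurable_fun [set: T] (fun t => limn_einf (F ^~ t)).
Proof.
move=> mF.
have me n : measurable_fun [set: T] (fun t => einfs (F ^~ t) n).
  exact: measurable_fun_einfs.
apply: (emeasurable_fun_cvg _ (fun t => limn_einf (F ^~ t)) me) => t _.
by rewrite limn_einf_lim; exact: is_cvg_einfs.
Qed.

Lemma limn_einf_ge0 (R : realType) (u : (\bar R)^nat) :
  (forall n, 0 <= u n) -> 0 <= limn_einf u.
Proof.
move=> u0; rewrite limn_einf_lim; apply: lime_ge; first exact: is_cvg_einfs.
by apply: nearW => n; apply: le_ereal_inf_tmp => _ [m _ <-].
Qed.

Lemma limn_einf_lt (R : realType) (u : (\bar R)^nat) (K : R) :
  limn_einf u < K%:E -> forall N, exists2 n, (N <= n)%N & u n <= K%:E.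
Proof.
move=> uK N.
have : einfs u N < K%:E.
  apply: le_lt_trans uK; rewrite limn_einf_lim.
  rewrite (cvg_lim _ (@cvg_einfs_sup _ u))//.
  by apply: ereal_sup_ubound; exists N.
move=> /ereal_inf_lt[_ [n Nn <-]] unK; exists n => //; exact: ltW.
Qed.

Lemma countType_bigcap_measurable dT (T : measurableType dT) (I : countType)
    (D : set I) (F : I -> set T) :
  (forall i, D i -> measurable (F i)) -> measurable (\bigcap_(i in D) F i).
Proof.
move=> mF; rewrite -[X in measurable X]setCK setC_bigcap; apply: measurableC.
by apply: countType_bigcup_measurable => i Di; apply: measurableC; exact: mF.
Qed.

Lemma countType_bigcup_negligible dT (T : measurableType dT) (R : realType)
    (mu : {measure set T -> \bar R}) (I : countType) (F : I -> set T) :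
  (forall i, mu.-negligible (F i)) -> mu.-negligible (\bigcup_(i in [set: I]) F i).
Proof.
move=> nF; pose H n := if unpickle n is Some i then F i else set0.
apply: (@negligibleS _ _ _ mu (\bigcup_n H n)).
  by move=> t [i _ Fi]; exists (pickle i) => //; rewrite /H pickleK.
apply: negligible_bigcup => n; rewrite /H; case: unpickle => [i|]; first exact: nF.
exact: negligible_set0.
Qed.

Lemma measurable_norm_gt (R : realType) dT (T : measurableType dT) (f : T -> R) (r : R) :
  measurable_fun [set: T] f -> measurable [set t | (r < `|f t|)%R].
Proof.
move=> mf; rewrite (_ : [set t | _] = (fun t => `|f t|%R) @^-1` `]r, +oo[).
  rewrite -[X in measurable X]setTI.
  suff mn : measurable_fun [set: T] (fun t => `|f t|%R) by apply: mn => //; exact: measurable_itv.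
  exact: measurableT_comp.
by apply/seteqP; split => t /=; rewrite in_itv/= andbT.
Qed.

Lemma indic_bool (R : realType) (T : Type) (A : set T) (b : bool) x :
  (A x <-> b) -> \1_A x = b%:R :> R.
Proof. by move=> Ab; rewrite indicE; congr (_%:R)%R; congr nat_of_bool; rewrite -[RHS]asboolb; apply: asbool_equiv_eq. Qed.

Section helly.
Context (R : realType) dT (T : measurableType dT) (I : countType).
(** The space [T] is seen through countably many real coordinates, and [mk] produces, measurably, a
    point with prescribed coordinates. The instance used below is the space of pairs of points. *)
Variables (c : I -> T -> R) (mk : (I -> R) -> T).
Hypothesis mc : forall i, measurable_fun [set: T] (c i).
Hypothesis mkK : forall v i, c i (mk v) = v i.
Hypothesis mmk : forall dU (U : measurableType dU) (Y : U -> I -> R),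
  (forall i, measurable_fun [set: U] (fun u => Y u i)) ->
  measurable_fun [set: U] (fun u => mk (Y u)).

Definition coord_cvg (t_ : nat -> T) (v : I -> R) :=
  forall i, c i (t_ n) @[n --> \oo] --> v i.

Definition coord_continuous_fun (f : T -> R) :=
  forall (t_ : nat -> T) t, coord_cvg t_ (c^~ t) -> f (t_ n) @[n --> \oo] --> f t.

(* Every test [c i t <= q], [q] rational, is one binary digit of [t]. *)
Definition bit (t : T) (k : nat) : bool :=
  if @unpickle (I * rat)%type k is Some (i, q) then (c i t <= ratr q)%R else false.

Lemma size_bits t n : size (mkseq (bit t) n) == n.
Proof. by rewrite size_mkseq. Qed.

Definition bits n t : n.-tuple bool := Tuple (size_bits t n).

Lemma measurable_bit k b : measurable [set t | bit t k = b].
Proof.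
rewrite /bit; case: unpickle => [[i q]|]; last first.
  case: b; [rewrite (_ : [set _ | _] = set0)//|rewrite (_ : [set _ | _] = setT)//];
  by apply/seteqP; split.
case: b.
  rewrite (_ : [set _ | _] = c i @^-1` `]-oo, ratr q]).
    by rewrite -[X in measurable X]setTI; apply: mc => //; exact: measurable_itv.
  by apply/seteqP; split => t /=; rewrite in_itv.
rewrite (_ : [set _ | _] = c i @^-1` `]ratr q, +oo[).
  by rewrite -[X in measurable X]setTI; apply: mc => //; exact: measurable_itv.
by apply/seteqP; split => t /=; rewrite in_itv/= andbT ltNge; [move=> ->|move/negbTE].
Qed.

Definition cyl (w : seq bool) : set T := [set t | mkseq (bit t) (size w) = w].

Lemma cyl_rcons w b : cyl (rcons w b) = cyl w `&` [set t | bit t (size w) = b].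
Proof.
apply/seteqP; split => t; rewrite /cyl/= size_rcons mkseqS.
  by move=> /rcons_inj[].
by move=> [-> ->].
Qed.

Lemma measurable_cyl w : measurable (cyl w).
Proof.
elim/last_ind: w => [|w b IH].
  by rewrite (_ : cyl _ = setT)//; apply/seteqP; split.
by rewrite cyl_rcons; apply: measurableI => //; exact: measurable_bit.
Qed.

Lemma bits_cyl n (w : n.-tuple bool) : bits n @^-1` [set w] = cyl w.
Proof.
apply/seteqP; split => t /=; rewrite /cyl/= size_tuple; first by move=> <-.
by move=> h; exact/val_inj.
Qed.

(* A subsequence along which the masses of all cylinders converge is represented
   on the unit interval by nested subdivisions; tightness makes almost every
   nested sequence of cylinders shrink to a point of [T].  The last clause says
   that [\int f dpi_oo] is at most the lower limit of [\int f dpi_(s n)]; it is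
   obtained by replacing [f] with its near-minimal values on the cylinders. *)
Lemma helly (pi : nat -> probability T R) :
  (forall i e, (0 < e)%R ->
    exists M : R, forall n, pi n [set t | (M < `|c i t|)%R] <= e%:E) ->
  exists (s : nat -> nat) (pi_oo : probability T R),
    (forall n, (n <= s n)%N) /\
    forall f : T -> R, measurable_fun [set: T] f -> (forall t, 0 <= f t)%R ->
      coord_continuous_fun f ->
      forall K : R,
        (forall N, exists2 n, (N <= n)%N & \int[pi (s n)]_t (f t)%:E <= K%:E) ->
        \int[pi_oo]_t (f t)%:E <= K%:E.
Proof.
move=> tight.
have fin_pi n w : pi n (cyl w) \is a fin_num.
  by apply: fin_num_measure; exact: measurable_cyl.
pose a n w := fine (pi n (cyl w)).
have a01 n w : (0 <= a n w <= 1)%R.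
  rewrite fine_ge0//= -lee_fin fineK// probability_le1//; exact: measurable_cyl.
have [s [p [sn ap]]] := countable_subsequence a01.
have a_rcons n w : a n w = (a n (rcons w false) + a n (rcons w true))%R.
  rewrite /a -fineD// -measureU; [|exact: measurable_cyl..|].
    congr (fine (pi n _)); rewrite !cyl_rcons -setIUr.
    rewrite [X in _ `&` X](_ : _ = setT) ?setIT//.
    by apply/seteqP; split => t //= _; case: bit; [right|left].
  by rewrite !cyl_rcons; apply/seteqP; split => t //= [[_ tf] [_]]; rewrite tf.
have p_nil : p [::] = 1%R.
  rewrite -(cvg_lim _ (ap [::]))//; apply/cvg_lim => //.
  rewrite (_ : (fun n => a (s n) [::]) = cst 1%R); first exact: cvg_cst.
  apply/funext => n; rewrite /a (_ : cyl [::] = setT) ?probability_setT//.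
  by apply/seteqP; split.
have p_ge0 w : (0 <= p w)%R.
  apply: (cvgr_to_ge (ap w)).
  by apply: nearW => n; have /andP[] := a01 (s n) w.
have p_rcons w : p w = (p (rcons w false) + p (rcons w true))%R.
  rewrite -(cvg_lim _ (ap w))//; apply/cvg_lim => //.
  rewrite (_ : (fun n => a (s n) w) =
    (fun n => a (s n) (rcons w false) + a (s n) (rcons w true))%R).
    by apply: cvgD; exact: ap.
  by apply/funext => n; exact: a_rcons.
pose P : probability (measurableTypeR R) R := @unit_leb R.
pose U (u : measurableTypeR R) n := interval_code_tuple p u n.
have PU l (w : l.-tuple bool) : P ((U^~ l) @^-1` [set w]) = (p w)%:E.
  exact: unit_leb_interval_code.
(* A function of the first l digits has a finite linear combination of cylinder masses as its
   integral. These masses converge along [s], so a bound holding infinitely often passes to the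
   limit. *)
have key l (g : l.-tuple bool -> R) (K : R) : (forall w, 0 <= g w)%R ->
    (forall N, exists2 n, (N <= n)%N & \int[pi (s n)]_t (g (bits l t))%:E <= K%:E) ->
    \int[P]_u (g (U u l))%:E <= K%:E.
  move=> g0 frq.
  have E n : \int[pi (s n)]_t (g (bits l t))%:E = (\sum_(w : l.-tuple bool) g w * a (s n) w)%:E.
    rewrite integral_fin_fun//; last by move=> w; rewrite bits_cyl; exact: measurable_cyl.
    by rewrite -sumEFin; apply: eq_bigr => w _; rewrite bits_cyl EFinM fineK.
  rewrite (@integral_fin_fun _ _ _ P _ (U^~ l) g)//; last by move=> w; exact: measurable_interval_code.
  rewrite (eq_bigr (fun w : l.-tuple bool => (g w * p w)%:E)); last first.
    by move=> w _; rewrite EFinM; congr (_ * _); exact: PU.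
  rewrite sumEFin lee_fin leNgt; apply/negP => Kl.
  have cv : (fun n => \sum_(w : l.-tuple bool) g w * a (s n) w)%R @ \oo -->
      (\sum_(w : l.-tuple bool) g w * p w)%R.
    apply: cvg_big => [|w _]; first exact: add_continuous.
    apply: cvgM; [exact: cvg_cst|exact: ap].
  have [N _ hN] := cvgr_gt _ cv _ Kl.
  have [n Nn] := frq N; rewrite E lee_fin leNgt; move/negP; apply.
  exact: hN.
pose bitU (u : measurableTypeR R) k := nth false (U u k.+1) k.
have mbitU k b : measurable [set u | bitU u k = b].
  have := @measurable_fin_fun R _ (measurableTypeR R) _ (U^~ k.+1) (fun w => (nth false w k == b)%:R : R)
     (fun w => measurable_interval_code p _) measurableT [set 1%R] (measurable_set1 _).
  rewrite setTI; congr measurable; apply/seteqP; split => u /=.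
    by rewrite /bitU; case: eqP => //= _ /eqP; rewrite eq_sym oner_eq0.
  by rewrite /bitU => ->; rewrite eqxx.
have bitU_le k b (e : R) : (forall n, pi n [set t | bit t k = b] <= e%:E) ->
    P [set u | bitU u k = b] <= e%:E.
  move=> pib.
  rewrite -(setIT [set u | _]) -integral_indic//.
  under eq_integral => u _.
    rewrite (_ : \1_[set u | bitU u k = b] u = (bitU u k == b)%:R); last first.
      by apply: indic_bool; split => [->|/eqP].
    over.
  apply: (key k.+1 (fun w => (nth false w k == b)%:R)) => // N; exists N => //.
  apply: le_trans (pib (s N)); rewrite -[in leRHS](setIT [set t | _]) -integral_indic//; last exact: measurable_bit.
  rewrite le_eqVlt; apply/orP; left; apply/eqP; apply: eq_integral => t _; congr EFin.
  by apply/esym/indic_bool; rewrite nth_mkseq//; split => [->|/eqP].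
(* The codes that decode to a point: for each coordinate some rational test succeeds and some fails,
   so that the coordinate escapes neither to -oo nor to +oo. *)
pose G : set (measurableTypeR R) := [set u | (0 <= u < 1)%R /\
  forall (i : I) b, exists q : rat, bitU u (pickle (i, q)) = b].
have mG : measurable G.
  rewrite (_ : G = `[0%R, 1%R[ `&` \bigcap_(i in [set: I]) \bigcap_(b in [set: bool])
      \bigcup_(q in [set: rat]) [set u | bitU u (pickle (i, q)) = b]).
    apply: measurableI; first exact: measurable_itv.
    apply: countType_bigcap_measurable => i _.
    apply: countType_bigcap_measurable => b _.
    by apply: countType_bigcup_measurable => q _; exact: mbitU.
  apply/seteqP; split => u /=; rewrite in_itv/=.
    by move=> [u01 h]; split => // i _ b _; have [q hq] := h i b; exists q.
  by move=> [u01 h]; split => // i b; have [q _ hq] := h i Logic.I b Logic.I; exists q.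
have aeG : P (~` G) = 0.
  have h1 : P (~` `[0%R, 1%R[) = 0.
    by rewrite /P/= /unit_leb/= /mrestr setICl measure0.
  have h2 (i : I) b : P.-negligible [set u | forall q : rat, bitU u (pickle (i, q)) = b].
    have mN : measurable [set u | forall q : rat, bitU u (pickle (i, q)) = b].
      rewrite (_ : [set u | _] = \bigcap_(q in [set: rat]) [set u | bitU u (pickle (i, q)) = b]).
        by apply: countType_bigcap_measurable => q _; exact: mbitU.
      by apply/seteqP; split => u h q; [move=> _; exact: h|exact: (h q Logic.I)].
    apply/negligibleP => //.
    apply/eqP; rewrite eq_le measure_ge0 andbT; apply/lee_addgt0Pr => e e0; rewrite add0e.
    have [M hM] := tight i e e0.
    (* If all tests succeed, the one at some q in ]-M-1, -M[ gives [c i t < - M]; if all fail, the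
       one at some q in ]M, M+1[ gives [c i t > M]. Tightness bounds both masses by [e]. *)
    pose x := (if b then - M - 1 else M)%R.
    have [q] := @rat_in_itvoo R x (x + 1)%R ltac:(by rewrite ltrDl).
    rewrite in_itv/= => /andP[xq qx].
    apply: (@le_trans _ _ (P [set u | bitU u (pickle (i, q)) = b])).
      by apply: le_measure; rewrite ?inE; [exact: mN|exact: mbitU|move=> u; exact].
    apply: bitU_le => n; apply: le_trans (hM n).
    apply: le_measure; rewrite ?inE; first exact: measurable_bit.
      exact: measurable_norm_gt.
    move=> t /=; rewrite /bit pickleK /x in xq qx *; case: b qx xq {x mN} => qx xq.
      by move=> ct; rewrite -normrN (lt_le_trans _ (ler_norm _))// ltrNr (le_lt_trans ct)// (lt_le_trans qx)// subrK.
    move=> /negbT; rewrite -ltNge => ct.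
    by rewrite (lt_le_trans _ (ler_norm _))// (lt_trans xq).
  apply/negligibleP; first exact: measurableC.
  apply: (@negligibleS _ _ _ P (~` `[0%R, 1%R[ `|`
      \bigcup_(ib in [set: I * bool]) [set u | forall q : rat, bitU u (pickle (ib.1, q)) = ib.2])).
    move=> u; apply: contra_notP => /not_orP[/contrapT u01 nh]; split.
      by move: u01; rewrite /= in_itv.
    move=> i b; apply: contrapT => /forallNP h; apply: nh; exists (i, ~~ b) => // q /=.
    by have := h q; case: (bitU _ _); case: b {h}.
  apply: negligibleU.
    by apply/negligibleP => //; apply: measurableC; exact: measurable_itv.
  apply: countType_bigcup_negligible => -[i b] /=.
  exact: h2.
(* The interval of the code contains [u], hence has positive length; an empty cylinder would have
   limit mass zero. *)
have cyl_nonempty u n : (0 <= u < 1)%R -> cyl (U u n) !=set0.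
  move=> u01; apply/set0P/eqP => c0.
  have := interval_code_itv p_nil p_rcons n u01 => /andP[lu ul].
  have : (0 < p (interval_code p u n).1)%R by rewrite -(ltrDl (left_end p (interval_code p u n).1)) (le_lt_trans lu).
  rewrite (_ : p _ = 0%R) ?ltxx//.
  rewrite -(cvg_lim _ (ap (interval_code p u n).1))//; apply/cvg_lim => //.
  rewrite (_ : (fun n => _) = cst 0%R); first exact: cvg_cst.
  by apply/funext => m; rewrite /a (_ : cyl _ = set0) ?measure0.
pose along (u : measurableTypeR R) (t_ : nat -> T) := forall n, cyl (U u n) (t_ n).
have along_bit u t_ : along u t_ -> forall k n, (k < n)%N -> bit (t_ n) k = bitU u k.
  move=> ut k n kn; have := ut n; rewrite /cyl/= (eqP (size_interval_code p u n)) => E.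
  rewrite /bitU/= (interval_code_prefix p u kn) nth_take// -E nth_mkseq//.
(* Coordinate [i] of the decoded point is the infimum of the rationals whose test succeeds. The
   nested cylinders may have an empty intersection; what matters is that any choice of points in
   them converges, in coordinates, to this value. *)
have exY u : exists y : I -> R,
    (G u -> forall t_, along u t_ -> coord_cvg t_ y) /\ (~ G u -> y = fun=> 0%R).
  have [Gu|nGu] := pselect (G u); last by exists (fun=> 0%R); split.
  have [u01 h] := Gu.
  pose S (i : I) := [set (ratr q : R) | q in [set q : rat | bitU u (pickle (i, q)) = true]].
  have [t0 t0u] : exists t0, along u t0.
    by have /choice[t0 h0] := fun n => cyl_nonempty u n u01; exists t0.
  have le_of_bit t_ i q : along u t_ -> forall n, (pickle (i, q) < n)%N ->
      (c i (t_ n) <= ratr q)%R = bitU u (pickle (i, q)).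
    by move=> ut n kn; rewrite -(along_bit _ _ ut _ _ kn) /bit pickleK.
  (* A failed test lies below a successful one: both digits are read on one actual point, taken in a
     cylinder deep enough to record both. *)
  have lbS i q' : bitU u (pickle (i, q')) = false -> lbound (S i) (ratr q').
    move=> bq' _ [q bq <-]; pose n := (maxn (pickle (i, q)) (pickle (i, q'))).+1.
    have := le_of_bit _ i q t0u n; rewrite ltnS leq_maxl bq => /(_ isT) h1.
    have := le_of_bit _ i q' t0u n; rewrite ltnS leq_maxr bq' => /(_ isT) /negbT.
    by rewrite -ltNge => /lt_le_trans /(_ h1) /ltW.
  exists (fun i => inf (S i)); split => // _ t_ ut i.
  have infS : has_inf (S i).
    have [q bq] := h i true; have [q' bq'] := h i false; split; first by exists (ratr q), q.
    by exists (ratr q'); exact: lbS.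
  apply/cvgrPdist_lt => e e0.
  have [_ [q bq <-] qe] := inf_adherent e0 infS.
  have [q'] := @rat_in_itvoo R (inf (S i) - e) (inf (S i)) ltac:(by rewrite ltrBlDr ltrDl).
  rewrite in_itv/= => /andP[eq' q'i].
  have bq' : bitU u (pickle (i, q')) = false.
    apply/negP => bq'; move: q'i; rewrite ltNge => /negP; apply.
    by apply: ge_inf; [exact: infS.2|exists q'].
  near=> n.
  have c1 := le_of_bit _ i q ut n; have c2 := le_of_bit _ i q' ut n.
  rewrite distrC ltr_distl; apply/andP; split.
    apply: (lt_trans eq'); rewrite ltNge c2 ?bq'//; near: n; exact: nbhs_infty_gt.
  apply: le_lt_trans qe; rewrite c1 ?bq//; near: n; exact: nbhs_infty_gt.
have [Y hY] := choice exY.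
have mfU l (g : l.-tuple bool -> R) :
    measurable_fun [set: measurableTypeR R] (fun u => g (U u l)).
  apply: (@measurable_fin_fun R _ (measurableTypeR R) _ (U^~ l)) => w.
  exact: measurable_interval_code.
pose t0 := mk (fun=> 0%R).
(* Fixed representatives of the cylinders exhibit [Y] as a pointwise limit of functions of finitely
   many digits, whence its measurability. *)
pose r l (w : l.-tuple bool) := xget t0 (cyl w).
have r_along u : G u -> along u (fun l => r l (U u l)).
  by move=> [u01 _] n; apply: xgetPex; exact: cyl_nonempty.
have mY i : measurable_fun [set: measurableTypeR R] (fun u => Y u i).
  apply: (@measurable_fun_cvg _ _ _ setT (fun l u => c i (r l (U u l)) * \1_G u)%R).
    move=> l; apply: measurable_funM; last exact: measurable_indic.
    exact: (mfU l (fun w => c i (r l w))).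
  move=> u _; have [Gu|nGu] := pselect (G u).
    rewrite indicE mem_set//; under eq_fun do rewrite mulr1.
    by apply: (hY u).1 => //; exact: r_along.
  rewrite ((hY u).2 nGu) indicE memNset//; under eq_fun do rewrite mulr0.
  exact: cvg_cst.
pose X u := mk (Y u).
have mX : measurable_fun [set: measurableTypeR R] X by exact: mmk.
pose X' : {mfun measurableTypeR R >-> T} := HB.pack X (isMeasurableFun.Build _ _ _ _ X mX).
exists s, (distribution P X'); split => // f mf f0 cf K frq.
rewrite ge0_integral_distribution//=; last exact/measurable_EFinP.
(* These representatives serve twice: they converge to [X u] along the cylinders, so the values of
   [f] converge by continuity; and their values exceed those of [f] on their cylinder by at most
   1/(l+1). *)
have exr (lw : nat * seq bool) : exists t, cyl lw.2 !=set0 ->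
    cyl lw.2 t /\ forall t', cyl lw.2 t' -> (f t <= f t' + lw.1.+1%:R^-1)%R.
  case: lw => l w /=; have [w0|] := pselect (cyl w !=set0); last by exists t0.
  have infS : has_inf [set f t | t in cyl w].
    by split; [case: w0 => t wt; exists (f t), t|exists 0%R => _ [t _ <-]].
  have l0 : (0 < l.+1%:R^-1 :> R)%R by rewrite invr_gt0 ltr0n.
  have [_ [t wt <-] ht] := inf_adherent l0 infS.
  exists t => _; split => // t' wt'; apply: (le_trans (ltW ht)); rewrite lerD2r.
  by apply: ge_inf; [exact: infS.2|exists t'].
have [r0 hr0] := choice exr.
pose r' l (w : l.-tuple bool) := r0 (l, w : seq bool).
have r'_along u : G u -> along u (fun l => r' l (U u l)).
  by move=> [u01 _] n; apply: (hr0 (n, _) _).1; exact: cyl_nonempty.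
pose F l (u : measurableTypeR R) := (f (r' l (U u l)))%:E.
have FX u : G u -> F ^~ u @ \oo --> (f (X u))%:E.
  move=> Gu; apply/fine_cvgP; split; first exact: nearW.
  apply: cf => i; rewrite mkK; apply: (hY u).1 => //; exact: r'_along.
have F_ge0 l u : 0 <= F l u by rewrite lee_fin.
have mF l : measurable_fun [set: measurableTypeR R] (F l).
  by apply/measurable_EFinP; exact: (mfU l (fun w => f (r' l w))).
(* Convergence is known only on [G]; the lower limit is defined everywhere and equals [f (X u)]
   almost surely. *)
rewrite (@ge0_ae_eq_integral _ _ _ _ setT _ (fun u => limn_einf (F ^~ u)))//; first last.
- exists (~` G); split; [exact: measurableC|exact: aeG|].
  move=> u /=; apply: contra_not => Gu _.
  by rewrite is_cvg_limn_einfE; [apply/esym/cvg_lim => //; exact: FX|apply/cvg_ex; eexists; exact: FX].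
- by move=> u _; exact: limn_einf_ge0.
- by move=> u _; rewrite lee_fin.
- exact: measurable_limn_einf.
- by apply/measurable_EFinP; apply: measurableT_comp.
apply: (le_trans (fatou _ _ _ _)) => //.
apply: limn_einf_le => e N e0.
have [l Nl le] : exists2 l, (N <= l)%N & (l.+1%:R^-1 < e)%R.
  have [M _ hM] := near_infty_natSinv_lt (PosNum e0).
  by exists (maxn N M); [exact: leq_maxl|apply: hM => /=; exact: leq_maxr].
exists l => //; apply: (key l (fun w => f (r' l w))) => // m.
have [n mn fn] := frq m; exists n => //.
apply: (@le_trans _ _ (\int[pi (s n)]_t ((f t)%:E + (l.+1%:R^-1)%:E))).
  apply: ge0_le_integral => //.
  - by move=> t _; rewrite lee_fin.
  - apply/measurable_EFinP; apply: (@measurable_fin_fun R _ T _ (bits l) (fun w => f (r' l w))) => w.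
    by rewrite bits_cyl; exact: measurable_cyl.
  - by apply: emeasurable_funD => //; exact/measurable_EFinP.
  - move=> t _; rewrite -EFinD lee_fin; apply: (hr0 (l, _) _).2; last by rewrite /cyl/= size_mkseq.
    by exists t; rewrite /cyl/= size_mkseq.
rewrite ge0_integralD//; [|by move=> t _; rewrite lee_fin|exact/measurable_EFinP].
rewrite integral_cst_proba EFinD; apply: leeD => //.
by rewrite lee_fin ltW.
Unshelve. all: by end_near. Qed.

End helly.

(** * Test functions *)

Section test_functions.
Context (R : realType) (d : nat).

(* [min 1 (max 0 z)], written so that continuity is immediate. *)
Definition clip (z : R) : R := ((`|z| - `|z - 1| + 1) / 2)%R.

Lemma clip_ge0 z : (0 <= clip z)%R.
Proof. by rewrite /clip; case: (ger0P z); case: (ger0P (z - 1)%R) => ? ?; lra. Qed.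

Lemma clip_le1 z : (clip z <= 1)%R.
Proof. by rewrite /clip; case: (ger0P z); case: (ger0P (z - 1)%R) => ? ?; lra. Qed.

Lemma clip_le z1 z2 : (z1 <= z2)%R -> (clip z1 <= clip z2)%R.
Proof.
rewrite /clip; case: (ger0P z1); case: (ger0P (z1 - 1)%R);
by case: (ger0P z2); case: (ger0P (z2 - 1)%R) => ? ? ? ? ?; lra.
Qed.

Lemma clip_le0 z : (z <= 0)%R -> clip z = 0%R.
Proof. by rewrite /clip; case: (ger0P z); case: (ger0P (z - 1)%R) => ? ? ?; lra. Qed.

Lemma clip_ge1 z : (1 <= z)%R -> clip z = 1%R.
Proof. by rewrite /clip; case: (ger0P z); case: (ger0P (z - 1)%R) => ? ? ?; lra. Qed.

Lemma measurable_clip : measurable_fun [set: R] clip.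
Proof.
have m1 : measurable_fun [set: R] (fun z => z - 1)%R by exact: measurable_funB.
apply: measurable_funM => //; apply: measurable_funD => //.
by apply: measurable_funB; [exact: normr_measurable|exact: measurableT_comp m1].
Qed.

Lemma clip_cvg (z_ : nat -> R) z : z_ n @[n --> \oo] --> z ->
  clip (z_ n) @[n --> \oo] --> clip z.
Proof.
move=> zz; apply: cvgM; last exact: cvg_cst.
apply: cvgD; last exact: cvg_cst.
by apply: cvgB; apply: cvg_norm => //; apply: cvgB => //; exact: cvg_cst.
Qed.

Definition test_index := ({ffun 'I_d -> rat} * nat)%type.

(** Each factor is a ramp that vanishes beyond the corner [j.1] and reaches 1 at distance 1/[j.2]
    below it, so the product increases with [j.2] to the indicator of the orthant. *)
Definition test (j : test_index) (x : Rd R d) : R :=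
  (\prod_(i < d) clip (j.2%:R * (ratr (j.1 i) - (x : 'rV[R]_d) ord0 i)))%R.

Lemma test_ge0 j x : (0 <= test j x)%R.
Proof. by apply: prodr_ge0 => i _; exact: clip_ge0. Qed.

Lemma test_le1 j x : (test j x <= 1)%R.
Proof. by apply: prodr_ile1 => i _; rewrite clip_ge0 clip_le1. Qed.

Lemma measurable_test j : measurable_fun [set: Rd R d] (test j).
Proof.
apply: measurable_prod => i _; apply: measurableT_comp; first exact: measurable_clip.
apply: measurable_funM => //; apply: measurable_funB => //; exact: measurable_coord.
Qed.

Lemma test_cvg j (x_ : nat -> Rd R d) (x : Rd R d) :
  (forall i, (x_ n : 'rV[R]_d) ord0 i @[n --> \oo] --> (x : 'rV[R]_d) ord0 i) ->
  test j (x_ n) @[n --> \oo] --> test j x.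
Proof.
move=> xx; apply: cvg_big => [|i _]; first exact: mul_continuous.
by apply: clip_cvg; apply: cvgM; [exact: cvg_cst|apply: cvgB; [exact: cvg_cst|exact: xx]].
Qed.

Lemma test_orthant q (x : Rd R d) :
  test (q, n) x @[n --> \oo] --> (\1_(orthant q) x : R).
Proof.
have [xq|xq] := pselect (orthant q x).
  rewrite indicE mem_set//.
  have -> : 1%:R = (\prod_(i < d) 1)%R :> R by rewrite big1.
  apply: cvg_big => [|i _]; first exact: mul_continuous.
  have iq : (0 < ratr (q i) - (x : 'rV[R]_d) ord0 i)%R by rewrite subr_gt0; exact: xq.
  apply: cvg_near_cst; near=> n; apply: clip_ge1 => /=.
  rewrite -ler_pdivrMr// div1r.
  by near: n; exact: nbhs_infty_ger.
rewrite indicE memNset//; apply: cvg_near_cst; apply: nearW => n.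
have [i xi] : exists i, ~ ((x : 'rV[R]_d) ord0 i < ratr (q i))%R by exact/existsNP.
rewrite /test (bigD1 i)//= clip_le0 ?mul0r// mulr_ge0_le0// subr_le0 leNgt.
exact/negP.
Unshelve. all: by end_near. Qed.

Lemma eq_proba_test (a b : probability (Rd R d) R) :
  (forall j, \int[a]_x (test j x)%:E = \int[b]_x (test j x)%:E) -> eq_proba a b.
Proof.
move=> ab; apply: eq_proba_orthant => q.
have E (m : probability (Rd R d) R) :
    \int[m]_x (test (q, n) x)%:E @[n --> \oo] --> m (orthant q).
  rewrite -[X in _ --> m X]setIT -integral_indic//; last exact: measurable_orthant.
  rewrite (eq_integral (fun x => limn (fun n => (test (q, n) x)%:E))); last first.
    move=> x _; apply/esym/cvg_lim => //; apply: cvg_EFin; last exact: test_orthant.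
    exact: nearW.
  apply: cvg_monotone_convergence => //.
  - by move=> n; apply/measurable_EFinP; exact: measurable_test.
  - by move=> n x _; rewrite lee_fin test_ge0.
  - move=> x _ m1 m2 m12; rewrite lee_fin; apply: ler_prod => i _.
    rewrite clip_ge0/=.
    have [xq|qx] := leP 0%R (ratr (q i) - (x : 'rV[R]_d) ord0 i)%R.
      by apply: clip_le; rewrite ler_wpM2r// ler_nat.
    by rewrite clip_le0 ?clip_ge0//= mulr_ge0_le0// ltW.
rewrite -(cvg_lim _ (E a))// -(cvg_lim _ (E b))//.
by congr (limn _); apply/funext => n; exact: ab.
Qed.

Definition test_mean (m : probability (Rd R d) R) (j : test_index) : R :=
  fine (\int[m]_x (test j x)%:E).

Lemma test_mean_fin (m : probability (Rd R d) R) j :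
  \int[m]_x (test j x)%:E = (test_mean m j)%:E.
Proof.
rewrite fineK// ge0_fin_numE; last first.
  by apply: integral_ge0 => x _; rewrite lee_fin test_ge0.
apply: (@le_lt_trans _ _ (\int[m]_x 1)); last by rewrite integral_cst_proba ltry.
apply: ge0_le_integral => //.
- by move=> x _; rewrite lee_fin test_ge0.
- by apply/measurable_EFinP; exact: measurable_test.
- by move=> x _; rewrite lee_fin test_le1.
Qed.

Lemma eq_proba_test_mean (a b : probability (Rd R d) R) :
  (forall j, test_mean a j = test_mean b j) -> eq_proba a b.
Proof. by move=> ab; apply: eq_proba_test => j; rewrite !test_mean_fin ab. Qed.

Lemma test_mean_eq (a b : probability (Rd R d) R) j :
  eq_proba a b -> test_mean a j = test_mean b j.
Proof.
by move=> ab; rewrite /test_mean; congr fine; apply: eq_measure_integral => A mA _; exact: ab.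
Qed.

(** Stands in for weak convergence. Limits are unique up to [eq_proba], because test means determine
    the masses of orthants by monotone convergence. *)
Definition test_cvg_to (a_ : nat -> probability (Rd R d) R) (a : probability (Rd R d) R) :=
  forall j, test_mean (a_ n) j @[n --> \oo] --> test_mean a j.

Lemma test_cvg_unique (a_ : nat -> probability (Rd R d) R) a b (s : nat -> nat) :
  (forall n, (n <= s n)%N) ->
  test_cvg_to a_ a -> test_cvg_to (fun n => a_ (s n)) b -> eq_proba a b.
Proof.
move=> sn aa ab; apply: eq_proba_test_mean => j.
have soo : s n @[n --> \oo] --> \oo.
  move=> A [N _ NA]; exists N => // n /= Nn; apply: NA => /=; exact: leq_trans (sn n).
have h := cvg_comp _ _ soo (aa j).
by rewrite -(cvg_lim _ h)// -(cvg_lim _ (ab j)).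
Qed.

End test_functions.

(** The conclusion of [helly] is one-sided. Used for a test function f and for 1 - f, it supplies
    these two hypotheses and thus full convergence of the test means. *)
Lemma cvg_frequently (R : realType) (u : nat -> R) (L : R) :
  (forall K, (forall N, exists2 n, (N <= n)%N & (u n <= K)%R) -> (L <= K)%R) ->
  (forall K, (forall N, exists2 n, (N <= n)%N & (1 - u n <= K)%R) -> (1 - L <= K)%R) ->
  u n @[n --> \oo] --> L.
Proof.
move=> h1 h2; apply/cvgrPdist_lt => e e0.
have [N1 hN1] : exists N, forall n, (N <= n)%N -> (L - e < u n)%R.
  apply: contrapT => /forallNP h; have : (L <= L - e)%R; last by rewrite leNgt ltrBlDr ltrDl e0.
  apply: h1 => N; have /existsNP[n /not_implyP[Nn /negP]] := h N.
  by rewrite -leNgt; exists n.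
have [N2 hN2] : exists N, forall n, (N <= n)%N -> (u n < L + e)%R.
  apply: contrapT => /forallNP h; have : (1 - L <= 1 - (L + e))%R; last by lra.
  apply: h2 => N; have /existsNP[n /not_implyP[Nn /negP]] := h N.
  by rewrite -leNgt => un; exists n => //; rewrite lerD2l lerN2.
exists (maxn N1 N2) => // n /=; rewrite geq_max => /andP[/hN1 ? /hN2 ?].
by rewrite distrC ltr_distl; apply/andP; split; lra.
Qed.

Lemma tail_small (R : realType) dT (T : measurableType dT) (m : probability T R) (f : T -> R)
    (e : R) : measurable_fun [set: T] f -> (0 < e)%R ->
  exists M : R, m [set t | (M < `|f t|)%R] <= e%:E.
Proof.
move=> mf e0; pose F n := [set t | (n%:R < `|f t|)%R].
have mF n : measurable (F n).
  exact: measurable_norm_gt.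
have F0 : \bigcap_n F n = set0.
  apply/seteqP; split => // t h; have [M _ hM] := nbhs_infty_ger `|f t|.
  have := h M Logic.I; rewrite /F/= ltNge => /negP; apply; by apply: hM => /=.
have : m (F n) @[n --> \oo] --> m (\bigcap_n F n).
  apply: nonincreasing_cvg_mu => //.
  - by apply: le_lt_trans (probability_le1 m (mF 0%N)) _; rewrite ltry.
  - by apply: bigcapT_measurable.
  - move=> n1 n2 n12; apply/subsetPset => t; rewrite /F/=; apply: le_lt_trans.
    by rewrite ler_nat.
rewrite F0 measure0 => /fine_cvgP[fin]; move=> /cvgrPdist_lt /(_ e e0) h.
near \oo => n.
exists n%:R; rewrite -[leLHS]fineK; last by near: n.
rewrite lee_fin; apply/ltW; apply: le_lt_trans (ler_norm _) _.
rewrite -normrN -[X in (`|X| < _)%R]add0r; near: n; exact: h.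
Unshelve. all: by end_near. Qed.

(** * Couplings *)

Lemma ge0_integral_marginal1 (R : realType) d1 d2 (X : measurableType d1)
    (Z : measurableType d2) (p : probability (X * Z)%type R) (f : X -> \bar R) :
  measurable_fun [set: X] f -> (forall x, 0 <= f x) ->
  \int[marginal1 p]_x f x = \int[p]_xz f xz.1.
Proof. by move=> mf f0; rewrite /marginal1 ge0_integral_distribution. Qed.

Lemma ge0_integral_marginal2 (R : realType) d1 d2 (X : measurableType d1)
    (Z : measurableType d2) (p : probability (X * Z)%type R) (f : Z -> \bar R) :
  measurable_fun [set: Z] f -> (forall x, 0 <= f x) ->
  \int[marginal2 p]_x f x = \int[p]_xz f xz.2.
Proof. by move=> mf f0; rewrite /marginal2 ge0_integral_distribution. Qed.

Section wasserstein.
Context (R : realType) (d : nat).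
Local Notation X := (Rd R d).
Implicit Types (a b : probability X R) (p : probability (X * X)%type R).

Lemma sqnorm_ge0 (x : 'rV[R]_d) : (0 <= sqnorm x)%R.
Proof. by apply: sumr_ge0 => i _; exact: sqr_ge0. Qed.

Lemma sqnormB (x y : 'rV[R]_d) :
  sqnorm (x - y)%R = (\sum_(i < d) (x ord0 i - y ord0 i) ^+ 2)%R.
Proof. by apply: eq_bigr => i _; rewrite !mxE. Qed.

Lemma sqnormBC (x y : 'rV[R]_d) : sqnorm (x - y)%R = sqnorm (y - x)%R.
Proof. by rewrite !sqnormB; apply: eq_bigr => i _; rewrite -sqrrN opprB. Qed.

Lemma measurable_sqnormB dT (T : measurableType dT) (f g : T -> X) :
  measurable_fun [set: T] f -> measurable_fun [set: T] g ->
  measurable_fun [set: T] (fun t => sqnorm ((f t : 'rV[R]_d) - (g t : 'rV[R]_d))%R).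
Proof.
move=> mf mg; under eq_fun do rewrite sqnormB.
apply: measurable_sum => i; apply: measurable_funX; apply: measurable_funB.
- exact: (measurableT_comp (@measurable_coord R d i) mf).
- exact: (measurableT_comp (@measurable_coord R d i) mg).
Qed.

Definition cost (xy : X * X) : R := sqnorm (xy.1 - xy.2)%R.

Lemma measurable_cost : measurable_fun [set: X * X] cost.
Proof. exact: measurable_sqnormB measurable_fst measurable_snd. Qed.

Lemma cost_ge0 xy : (0 <= cost xy)%R.
Proof. exact: sqnorm_ge0. Qed.

Definition pair_coord (i : 'I_d + 'I_d) (xy : X * X) : R :=
  match i with
  | inl i => (xy.1 : 'rV[R]_d) ord0 i
  | inr i => (xy.2 : 'rV[R]_d) ord0 i
  end.

Definition pair_of_coord (v : 'I_d + 'I_d -> R) : X * X :=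
  (\row_i v (inl i), \row_i v (inr i))%R.

Lemma measurable_pair_coord i : measurable_fun [set: X * X] (pair_coord i).
Proof.
case: i => i.
- exact: (measurableT_comp (@measurable_coord R d i) measurable_fst).
- exact: (measurableT_comp (@measurable_coord R d i) measurable_snd).
Qed.

Lemma pair_of_coordK v i : pair_coord i (pair_of_coord v) = v i.
Proof. by case: i => i; rewrite /= mxE. Qed.

Lemma measurable_pair_of_coord dU (U : measurableType dU) (Y : U -> 'I_d + 'I_d -> R) :
  (forall i, measurable_fun [set: U] (fun u => Y u i)) ->
  measurable_fun [set: U] (fun u => pair_of_coord (Y u)).
Proof.
move=> mY; apply/measurable_fun_pairP; split; apply: measurable_fun_coord => i /=.
- by under eq_fun do rewrite mxE; exact: mY.
- by under eq_fun do rewrite mxE; exact: mY.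
Qed.

Lemma cost_continuous : coord_continuous_fun pair_coord cost.
Proof.
move=> t_ t tt; rewrite /cost sqnormB; under eq_fun do rewrite sqnormB.
apply: cvg_big => [|i _]; first exact: add_continuous.
under eq_fun do rewrite expr2; rewrite expr2.
by apply: cvgM; exact: (cvgB (tt (inl i)) (tt (inr i))).
Qed.

Lemma markov_cost p i (M N : R) : (0 < N)%R -> \int[p]_xy (cost xy)%:E <= M%:E ->
  p [set xy | (N < `|pair_coord (inl i) xy - pair_coord (inr i) xy|)%R] <= (M / N ^+ 2)%:E.
Proof.
move=> N0 pM; set A := [set xy | _].
have mA : measurable A.
  by apply: measurable_norm_gt; apply: measurable_funB; exact: measurable_pair_coord.
rewrite EFinM lee_pdivlMr ?exprn_gt0// muleC; apply: le_trans pM.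
have <- : \int[p]_xy (\1_A xy)%:E = p A by rewrite integral_indic// setIT.
rewrite -ge0_integralZl//; first last.
- by rewrite lee_fin exprn_ge0// ltW.
- by apply/measurable_EFinP; exact: measurable_indic.
apply: ge0_le_integral => //.
- by move=> xy _; rewrite -EFinM lee_fin mulr_ge0// exprn_ge0// ltW.
- by apply/measurable_EFinP; apply: measurable_funM => //; exact: measurable_indic.
- by apply/measurable_EFinP; exact: measurable_cost.
move=> xy _; rewrite -EFinM lee_fin indicE.
have [/set_mem Axy|_] := boolP (xy \in A); last by rewrite mulr0 cost_ge0.
rewrite mulr1 /cost sqnormB (bigD1 i)//= -[leLHS]addr0 lerD ?sumr_ge0//.
  rewrite -[leRHS]real_normK ?num_real// lerXn2r ?nnegrE ?normr_ge0// ltW//.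
by move=> j _; exact: sqr_ge0.
Qed.

(** The measures [b_ n] are not assumed tight. The first marginal is fixed, hence tight, and by
    Markov's inequality the bounded cost keeps the second coordinates close to the first. *)
Lemma coupling_compact a (b_ : nat -> probability X R)
    (p_ : nat -> probability (X * X)%type R) (M : R) :
  (forall n, coupling a (b_ n) (p_ n)) ->
  (forall n, \int[p_ n]_xy (cost xy)%:E <= M%:E) ->
  exists (s : nat -> nat) (p : probability (X * X)%type R),
    [/\ forall n, (n <= s n)%N,
      coupling a (marginal2 p) p,
      test_cvg_to (fun n => b_ (s n)) (marginal2 p) &
      forall K : R,
        (forall N, exists2 n, (N <= n)%N & \int[p_ (s n)]_xy (cost xy)%:E <= K%:E) ->
        \int[p]_xy (cost xy)%:E <= K%:E].
Proof.
move=> ab_ pM.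
have M0 : (0 <= M)%R.
  rewrite -lee_fin; apply: le_trans (pM 0%N).
  by apply: integral_ge0 => xy _; rewrite lee_fin cost_ge0.
have tight1 i e : (0 < e)%R -> exists N : R, (0 < N)%R /\ forall n,
    p_ n [set xy | (N < `|pair_coord (inl i) xy|)%R] <= e%:E.
  move=> e0; have [N aN] := tail_small a (@measurable_coord R d i) e0.
  exists (Num.max N 1%R); split; first by rewrite lt_max ltr01 orbT.
  move=> n; apply: le_trans aN.
  have mN r : measurable [set x : X | (r < `|(x : 'rV[R]_d) ord0 i|)%R].
    by apply: measurable_norm_gt; exact: measurable_coord.
  apply: le_trans (_ : a [set x : X | (Num.max N 1 < `|(x : 'rV[R]_d) ord0 i|)%R] <= _).
    by rewrite -((ab_ n).1 _ (mN (Num.max N 1%R))).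
  apply: le_measure; rewrite ?inE; [exact: mN|exact: mN|].
  by move=> x /=; rewrite gt_max => /andP[].
have tight i e : (0 < e)%R ->
    exists N : R, forall n, p_ n [set xy | (N < `|pair_coord i xy|)%R] <= e%:E.
  case: i => i e0; first by have [N [_ hN]] := tight1 i e e0; exists N.
  have e20 : (0 < e / 2)%R by rewrite divr_gt0.
  have [N1 [N10 hN1]] := tight1 i _ e20.
  (* This choice gives M <= (e/2) N2 and N2 >= 1, hence M / N2^2 <= e/2; the other half of [e] pays
     for the first coordinate. *)
  pose N2 := (2 * M / e + 1)%R.
  have N20 : (0 < N2)%R by rewrite ltr_wpDl// divr_ge0 ?mulr_ge0// ltW.
  have mN j r : measurable [set xy : X * X | (r < `|pair_coord j xy|)%R].
    by apply: measurable_norm_gt; exact: measurable_pair_coord.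
  have mD r : measurable [set xy : X * X |
      (r < `|pair_coord (inl i) xy - pair_coord (inr i) xy|)%R].
    by apply: measurable_norm_gt; apply: measurable_funB; exact: measurable_pair_coord.
  exists (N1 + N2)%R => n.
  apply: (@le_trans _ _ (p_ n ([set xy | (N1 < `|pair_coord (inl i) xy|)%R] `|`
     [set xy | (N2 < `|pair_coord (inl i) xy - pair_coord (inr i) xy|)%R]))).
    apply: le_measure; rewrite ?inE; [exact: mN|exact: measurableU|].
    move=> xy /= h; apply: contrapT => /not_orP[/negP + /negP]; rewrite -!leNgt => h1 h2.
    move: h; apply/negP; rewrite -leNgt.
    have h3 (x y : R) : (`|y| <= `|x| + `|x - y|)%R.
      by rewrite -{1}(subKr x y) ler_normB.
    exact: le_trans (h3 (pair_coord (inl i) xy) (pair_coord (inr i) xy)) (lerD h1 h2).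
  apply: (le_trans (measureU2 _ _ _)) => //.
  rewrite (splitr e) EFinD; apply: leeD; first exact: hN1.
  apply: (le_trans (markov_cost i N20 (pM n))); rewrite lee_fin.
  rewrite ler_pdivrMr ?exprn_gt0//.
  have h : (M <= e / 2 * N2)%R by rewrite /N2 mulrDr; have -> : (e / 2 * (2 * M / e) = M)%R; [by field; rewrite gt_eqF|rewrite mulr1 lerDl ltW].
  apply: (le_trans h); rewrite ler_pM2l// expr2 ler_peMl ?(ltW N20)//.
  by rewrite /N2 lerDr divr_ge0 ?mulr_ge0// ltW.
have [s [p [sn hp]]] := helly measurable_pair_coord pair_of_coordK measurable_pair_of_coord tight.
have sub1 (f : X * X -> R) : coord_continuous_fun pair_coord f ->
    coord_continuous_fun pair_coord (fun xy => 1 - f xy)%R.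
  by move=> cf t_ t tt; apply: cvgB; [exact: cvg_cst|exact: cf].
have test1 j : coord_continuous_fun pair_coord (fun xy => test j xy.1).
  by move=> t_ t tt; apply: test_cvg => i; exact: (tt (inl i)).
have test2 j : coord_continuous_fun pair_coord (fun xy => test j xy.2).
  by move=> t_ t tt; apply: test_cvg => i; exact: (tt (inr i)).
have test_sub1 j (m : probability X R) : \int[m]_x (1 - test j x)%:E = (1 - test_mean m j)%:E.
  have fin1 : m.-integrable [set: X] (fun x => (test j x)%:E).
    apply/integrableP; split; first by apply/measurable_EFinP; exact: measurable_test.
    under eq_integral do rewrite gee0_abs ?lee_fin ?test_ge0//.
    by rewrite test_mean_fin ltry.
  under eq_integral do rewrite EFinB.
  rewrite integralB//; first by rewrite integral_cst_proba test_mean_fin.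
  exact: finite_measure_integrable_cst.
have cvg_test (g : X * X -> X) (m_ : nat -> probability X R) (m : probability X R) :
    measurable_fun [set: X * X] g ->
    (forall j, coord_continuous_fun pair_coord (fun xy => test j (g xy))) ->
    (forall n (f : X -> \bar R), measurable_fun [set: X] f -> (forall x, 0 <= f x) ->
       \int[m_ n]_x f x = \int[p_ (s n)]_xy f (g xy)) ->
    (forall (f : X -> \bar R), measurable_fun [set: X] f -> (forall x, 0 <= f x) ->
       \int[m]_x f x = \int[p]_xy f (g xy)) ->
    test_cvg_to m_ m.
  move=> mg cg im_ im j.
  have mt : measurable_fun [set: X * X] (fun xy => test j (g xy)).
    by apply: measurableT_comp => //; exact: measurable_test.
  apply: cvg_frequently => K frq; rewrite -lee_fin.
    rewrite -test_mean_fin im; [|by apply/measurable_EFinP; exact: measurable_test|by move=> x; rewrite lee_fin test_ge0].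
    apply: (hp (fun xy => test j (g xy))) => // [xy|N]; first exact: test_ge0.
    have [n Nn] := frq N; rewrite -lee_fin -test_mean_fin im_; last 2 first.
    - by apply/measurable_EFinP; exact: measurable_test.
    - by move=> x; rewrite lee_fin test_ge0.
    by exists n.
  have mt1 : measurable_fun [set: X] (fun x => (1 - test j x)%:E).
    by apply/measurable_EFinP; apply: measurable_funB => //; exact: measurable_test.
  have t10 x : 0 <= (1 - test j x)%:E by rewrite lee_fin subr_ge0 test_le1.
  rewrite -test_sub1 im//.
  apply: (hp (fun xy => 1 - test j (g xy))%R) => // [|xy||N].
  - exact: measurable_funB.
  - by rewrite subr_ge0 test_le1.
  - exact: sub1.
  have [n Nn] := frq N; rewrite -lee_fin -test_sub1 im_//.
  by exists n.
exists s, p; split => //.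
- split => //; apply: (@eq_proba_test_mean R d) => j.
  have := cvg_test fst (fun n => marginal1 (p_ (s n))) (marginal1 p) measurable_fst test1
    (fun n => @ge0_integral_marginal1 _ _ _ _ _ (p_ (s n))) (@ge0_integral_marginal1 _ _ _ _ _ p) j.
  move=> h; rewrite -(cvg_lim _ h)//; apply/cvg_lim => //.
  under eq_fun => n do rewrite (test_mean_eq j (ab_ (s n)).1).
  exact: cvg_cst.
- move=> j.
  have := cvg_test snd (fun n => marginal2 (p_ (s n))) (marginal2 p) measurable_snd test2
    (fun n => @ge0_integral_marginal2 _ _ _ _ _ (p_ (s n))) (@ge0_integral_marginal2 _ _ _ _ _ p) j.
  by under eq_fun => n do rewrite (test_mean_eq j (ab_ (s n)).2).
- move=> K frq; apply: hp => //; [exact: measurable_cost|exact: cost_ge0|exact: cost_continuous].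
Qed.

End wasserstein.

(** * Attainment, semicontinuity and measurability of the Wasserstein cost *)

Section wasserstein_properties.
Context (R : realType) (d : nat).
Local Notation X := (Rd R d).
Implicit Types (a b : probability X R) (p : probability (X * X)%type R).

Lemma integral_cost_ge0 p : 0 <= \int[p]_xy (cost xy)%:E.
Proof. by apply: integral_ge0 => xy _; rewrite lee_fin cost_ge0. Qed.

Lemma W2sq_ge0 a b : 0 <= W2sq a b.
Proof. by apply: le_ereal_inf_tmp => _ [p _ <-]; exact: integral_cost_ge0. Qed.

Lemma W2sq_le a b p : coupling a b p -> W2sq a b <= \int[p]_xy (cost xy)%:E.
Proof. by move=> abp; apply: ereal_inf_lbound; exists p. Qed.

Lemma W2sq_le_swap a b : W2sq b a <= W2sq a b.
Proof.
apply: le_ereal_inf_tmp => _ [p [h1 h2] <-].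
have msw : measurable_fun [set: X * X] (fun xy : X * X => (xy.2, xy.1)).
  by apply/measurable_fun_pairP; split; [exact: measurable_snd|exact: measurable_fst].
pose sw : {mfun (X * X)%type >-> (X * X)%type} :=
  HB.pack (fun xy : X * X => (xy.2, xy.1)) (isMeasurableFun.Build _ _ _ _ _ msw).
apply: le_trans (W2sq_le (p := distribution p sw) _) _.
  by split => A mA; [exact: h2|exact: h1].
rewrite ge0_integral_distribution//=; [|by apply/measurable_EFinP; exact: measurable_cost|by move=> xy; rewrite lee_fin cost_ge0].
rewrite le_eqVlt; apply/orP; left; apply/eqP; apply: eq_integral => xy _ /=.
by rewrite /cost/= sqnormBC.
Qed.

Lemma W2sqC a b : W2sq a b = W2sq b a.
Proof. by apply/eqP; rewrite eq_le !W2sq_le_swap. Qed.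

Lemma W2sq_lt_coupling a b (K : \bar R) : W2sq a b < K ->
  exists2 p, coupling a b p & \int[p]_xy (cost xy)%:E < K.
Proof. by move=> /ereal_inf_lt[_ [p pab <-] pK]; exists p. Qed.

Lemma W2sq_compact a (b_ : nat -> probability X R) (M : R) :
  (forall n, W2sq a (b_ n) <= M%:E) ->
  exists (s : nat -> nat) b, (forall n, (n <= s n)%N) /\ test_cvg_to (fun n => b_ (s n)) b.
Proof.
move=> h; have hM n : exists p, coupling a (b_ n) p /\ \int[p]_xy (cost xy)%:E <= (M + 1)%:E.
  have [|p pc pM] := @W2sq_lt_coupling a (b_ n) (M + 1)%:E.
    by rewrite (le_lt_trans (h n))// lte_fin ltrDl.
  by exists p; split => //; exact: ltW.
have [p_ hp] := choice hM.
have [s [p [sn _ cv _]]] := coupling_compact (fun n => (hp n).1) (fun n => (hp n).2).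
by exists s, (marginal2 p).
Qed.

(** Near-optimal couplings, with errors 1/(n+1), have a limit by [coupling_compact]. Keeping that
    coupling in the conclusion lets the constant sequence produce an optimal one in
    [W2sq_attained]. *)
Lemma W2sq_lsc_coupling a b (b_ : nat -> probability X R) (K : R) :
  test_cvg_to b_ b -> (forall n, W2sq a (b_ n) <= K%:E) ->
  exists2 p, coupling a b p & \int[p]_xy (cost xy)%:E <= K%:E.
Proof.
move=> bb h.
have hM n : exists p, coupling a (b_ n) p /\ \int[p]_xy (cost xy)%:E <= (K + n.+1%:R^-1)%:E.
  have [|p pc pM] := @W2sq_lt_coupling a (b_ n) (K + n.+1%:R^-1)%:E.
    by rewrite (le_lt_trans (h n))// lte_fin ltrDl invr_gt0.
  by exists p; split => //; exact: ltW.
have [p_ hp] := choice hM.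
have hp1 n : \int[p_ n]_xy (cost xy)%:E <= (K + 1)%:E.
  by apply: le_trans (hp n).2 _; rewrite lee_fin lerD2l invf_le1// ler1n.
have [s [p [sn [c1 c2] cv hK]]] := coupling_compact (fun n => (hp n).1) hp1.
exists p.
  by split => // A mA; rewrite (test_cvg_unique sn bb cv).
apply/lee_addgt0Pr => e e0; rewrite -EFinD; apply: hK => N.
have [M _ hM'] := near_infty_natSinv_lt (PosNum e0).
exists (maxn N M); first exact: leq_maxl.
apply: le_trans (hp _).2 _; rewrite lee_fin lerD2l ltW//; apply: hM' => /=.
exact: leq_trans (leq_maxr _ _) (sn _).
Qed.

Lemma W2sq_lsc a b (b_ : nat -> probability X R) (K : R) :
  test_cvg_to b_ b -> (forall n, W2sq a (b_ n) <= K%:E) -> W2sq a b <= K%:E.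
Proof.
by move=> bb h; have [p pab pK] := W2sq_lsc_coupling bb h; apply: le_trans (W2sq_le pab) pK.
Qed.

Lemma W2sq_attained a b : W2sq a b < +oo ->
  exists2 p, coupling a b p & \int[p]_xy (cost xy)%:E = W2sq a b.
Proof.
move=> fin.
have WE : W2sq a b = (fine (W2sq a b))%:E by rewrite fineK// ge0_fin_numE// W2sq_ge0.
have [||p pab pK] := @W2sq_lsc_coupling a b (fun=> b) (fine (W2sq a b)).
- by move=> j; exact: cvg_cst.
- by move=> n; rewrite -WE.
exists p => //; apply/eqP; rewrite eq_le W2sq_le// andbT.
by rewrite WE.
Qed.

Lemma measurable_test_mean dZ (Z : measurableType dZ) (k : Z -> pprobability X R) j :
  measurable_fun [set: Z] k -> measurable_fun [set: Z] (fun z => test_mean (k z) j).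
Proof.
move=> mk; apply: measurableT_comp => //.
(* Evaluations at measurable sets are measurable along [k], so [k] is also measurable into the Giry
   space, where the integral of a nonnegative function depends measurably on the measure. *)
pose kg (z : Z) : giry X R := k z.
have mkg : measurable_fun [set: Z] kg.
  apply: measurable_giry_codensity => // B mB.
  exact: (measurable_kernel (kprobability mk) B mB).
apply: (measurableT_comp (@measurable_giry_int _ X R (fun x => (test j x)%:E) _ _) mkg).
- by apply/measurable_EFinP; exact: measurable_test.
- by move=> x; rewrite lee_fin test_ge0.
Qed.

(* Sublevel sets are closed for the convergence of countably many test means,
   hence countable intersections of preimages of closed sets of ['rV[R]_N]. *)
Lemma measurable_W2sq dZ (Z : measurableType dZ) (k : Z -> pprobability X R) b :
  measurable_fun [set: Z] k -> measurable_fun [set: Z] (fun z => W2sq (k z) b).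
Proof.
move=> mk.
pose tn a n := if @unpickle (test_index d) n is Some j then test_mean a j else 0%R.
pose v N a : Rd R N := (\row_(n < N) tn a n)%R.
have mv N : measurable_fun [set: Z] (fun z => v N (k z)).
  apply: measurable_fun_coord => i; under eq_fun do rewrite mxE.
  rewrite /tn; case: unpickle => [j|]; last exact: measurable_cst.
  exact: (measurable_test_mean j mk).
pose A (r : R) N : set (Rd R N) := closure [set v N a | a in [set a | W2sq a b <= r%:E]].
have mA r N : measurable (A r N).
  rewrite -[A r N]setCK; apply: measurableC; apply: sub_sigma_algebra.
  by rewrite openC; exact: closed_closure.
have key r : [set z | W2sq (k z) b <= r%:E] = \bigcap_N ((fun z => v N (k z)) @^-1` A r N).
  apply/seteqP; split => z /=.
    by move=> h N _; apply: subset_closure; exists (k z).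
  move=> h.
  (* Taking closures adds nothing to the intersection: test j enters every vector of length N >
     [pickle j], so the approximants at precision 1/(N+1) converge to [k z] against all tests, and
     semicontinuity applies. *)
  have exa N : exists a, W2sq a b <= r%:E /\ forall n, (n < N)%N ->
      (`|tn (k z) n - tn a n| < N.+1%:R^-1)%R.
    have N0 : (0 < N.+1%:R^-1 :> R)%R by rewrite invr_gt0.
    have [_ [[a ab <-] [_ va]]] := h N Logic.I _ (nbhsx_ballx (v N (k z) : 'rV[R]_N) _ N0).
    exists a; split => // n nN; have := va ord0 (Ordinal nN).
    by rewrite /ball/= !mxE.
  have [a_ ha] := choice exa.
  rewrite W2sqC; apply: (@W2sq_lsc _ _ a_).
    move=> j; apply/cvgrPdist_lt => e e0; near=> N.
    have := (ha N).2 (pickle j); rewrite /tn pickleK => jN.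
    apply: (lt_trans (jN _)); first by near: N; exact: nbhs_infty_gt.
    by near: N; exact: near_infty_natSinv_lt (PosNum e0).
  by move=> n; rewrite W2sqC; exact: (ha n).1.
apply: (measurability _ (ErealGenOInfty.measurableE R)) => _ [_ [r ->] <-].
rewrite setTI (_ : _ @^-1` _ = ~` [set z | W2sq (k z) b <= r%:E]).
  apply: measurableC; rewrite key; apply: bigcapT_measurable => N.
  by rewrite -[X in measurable X]setTI; exact: mv.
apply/seteqP; split => z /=; rewrite in_itv/= andbT ltNge; first by move/negP.
by move=> /negP.
Unshelve. all: by end_near. Qed.

End wasserstein_properties.

(** * Existence of barycenters *)

Section barycenter_existence.
Context (R : realType) (d : nat) dZ (Z : measurableType dZ).
Local Notation X := (Rd R d).
Context (nu : probability Z R) (k : Z -> pprobability X R).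
Hypothesis mk : measurable_fun [set: Z] k.

Lemma le_limn_einf_W2sq a (u : nat -> probability X R) b : test_cvg_to u b ->
  W2sq a b <= limn_einf (fun n => W2sq a (u n)).
Proof.
move=> ub; set L := limn_einf _.
have [->|Loo] := eqVneq L +oo; first exact: leey.
have LE : L = (fine L)%:E.
  by rewrite fineK// ge0_fin_numE ?ltey// limn_einf_ge0// => n; exact: W2sq_ge0.
rewrite LE; apply/lee_addgt0Pr => e e0.
have Le : L < (fine L + e)%:E by rewrite {1}LE lte_fin ltrDl.
have /choice[s hs] : forall N, exists n, (N <= n)%N /\ W2sq a (u n) <= (fine L + e)%:E.
  by move=> N; have [n Nn h] := limn_einf_lt Le N; exists n.
apply: (@W2sq_lsc _ _ _ _ (fun n => u (s n))) => [j|n]; last exact: (hs n).2.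
apply: cvg_comp (ub j).
by move=> A [N _ NA]; exists N => // n /= Nn; apply: NA => /=; exact: leq_trans (hs n).1.
Qed.

Lemma barycenter_exists :
  ereal_inf [set \int[nu]_z W2sq (k z) b | b in [set: probability X R]] < +oo ->
  exists b, barycenter nu k b.
Proof.
rewrite /barycenter; set C := ereal_inf _ => Coo.
have C0 : 0 <= C.
  by apply: le_ereal_inf_tmp => _ [b _ <-]; apply: integral_ge0 => z _; exact: W2sq_ge0.
have CE : C = (fine C)%:E by rewrite fineK// ge0_fin_numE.
have exb n : exists b, \int[nu]_z W2sq (k z) b <= (fine C + n.+1%:R^-1)%:E.
  have : C < (fine C + n.+1%:R^-1)%:E by rewrite {1}CE lte_fin ltrDl invr_gt0.
  by move=> /ereal_inf_lt[_ [b _ <-] h]; exists b; exact: ltW.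
have [b_ hb] := choice exb.
have liminf_le (t : nat -> nat) : (forall n, (n <= t n)%N) ->
    limn_einf (fun n => \int[nu]_z W2sq (k z) (b_ (t n))) <= C.
  move=> tn; rewrite CE; apply: limn_einf_le => e N e0.
  have [M _ hM] := near_infty_natSinv_lt (PosNum e0).
  exists (maxn N M); first exact: leq_maxl.
  apply: le_trans (hb _) _; rewrite lee_fin lerD2l ltW//; apply: hM => /=.
  exact: leq_trans (leq_maxr _ _) (tn _).
(* Stated for every extraction because it is used twice: on the whole sequence to find [z0], then on
   the subsequence that converges. *)
have fatou_le (t : nat -> nat) : (forall n, (n <= t n)%N) ->
    \int[nu]_z limn_einf (fun n => W2sq (k z) (b_ (t n))) <= C.
  move=> tn; apply: le_trans (liminf_le t tn); apply: fatou => // [n|n z _].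
  - exact: measurable_W2sq.
  - exact: W2sq_ge0.
have [z0 hz0] : exists z, limn_einf (fun n => W2sq (k z) (b_ n)) < +oo.
  apply: contrapT => /forallNP h; move: Coo; apply/negP; rewrite -leNgt.
  apply: le_trans (fatou_le id _) => //.
  rewrite (eq_integral (cst +oo)); last first.
    by move=> z _; apply/eqP; rewrite -leye_eq leNgt; exact/negP.
  by rewrite integral_cst_proba.
have [r hr] : exists r : R, limn_einf (fun n => W2sq (k z0) (b_ n)) < r%:E.
  have : limn_einf (fun n => W2sq (k z0) (b_ n)) \is a fin_num.
    by rewrite ge0_fin_numE// limn_einf_ge0// => n; exact: W2sq_ge0.
  by move=> /fineK <-; exists (fine (limn_einf (fun n => W2sq (k z0) (b_ n))) + 1)%R; rewrite lte_fin ltrDl.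
have /choice[s0 hs0] : forall N, exists n, (N <= n)%N /\ W2sq (k z0) (b_ n) <= r%:E.
  by move=> N; have [n Nn h] := limn_einf_lt hr N; exists n.
have [s1 [b [hs1 cb]]] := W2sq_compact (fun n => (hs0 n).2).
pose t n := s0 (s1 n).
have tn n : (n <= t n)%N by exact: leq_trans (hs1 n) (hs0 _).1.
exists b; apply/eqP; rewrite eq_le; apply/andP; split; last by apply: ereal_inf_lbound; exists b.
apply: le_trans (fatou_le t tn); apply: ge0_le_integral => //.
- by move=> z _; exact: W2sq_ge0.
- exact: measurable_W2sq.
- by apply: measurable_limn_einf => n; exact: measurable_W2sq.
- by move=> z _; exact: le_limn_einf_W2sq.
Qed.

End barycenter_existence.

(** * Second moments and dilations *)

Lemma ge0_integral_comb (R : realType) dT (T : measurableType dT)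
    (m : {measure set T -> \bar R}) (f g : T -> R) (u v : R) :
  (0 <= u)%R -> (0 <= v)%R -> (forall t, 0 <= f t)%R -> (forall t, 0 <= g t)%R ->
  measurable_fun [set: T] f -> measurable_fun [set: T] g ->
  \int[m]_t (u * f t + v * g t)%:E =
    u%:E * \int[m]_t (f t)%:E + v%:E * \int[m]_t (g t)%:E.
Proof.
move=> u0 v0 f0 g0 mf mg.
under eq_integral do rewrite EFinD !EFinM.
rewrite ge0_integralD//.
- by rewrite !ge0_integralZl//; (try exact/measurable_EFinP); move=> t _; rewrite lee_fin.
- by move=> t _; rewrite -EFinM lee_fin mulr_ge0.
- by apply/measurable_EFinP; exact: measurable_funM.
- by move=> t _; rewrite -EFinM lee_fin mulr_ge0.
- by apply/measurable_EFinP; exact: measurable_funM.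
Qed.

Section moments.
Context (R : realType) (d : nat).
Local Notation X := (Rd R d).
Implicit Types (a : 'rV[R]_d) (b : probability X R).

Definition moment a b : \bar R := \int[b]_x (sqnorm ((x : 'rV[R]_d) - a)%R)%:E.

Lemma measurable_sqnorm_sub a : measurable_fun [set: X] (fun x : X => sqnorm ((x : 'rV[R]_d) - a)%R).
Proof. exact: (@measurable_sqnormB _ _ _ X id (cst (a : X))). Qed.

Lemma moment_ge0 a b : 0 <= moment a b.
Proof. by apply: integral_ge0 => x _; rewrite lee_fin sqnorm_ge0. Qed.

Lemma moment_eq_proba a b b' : eq_proba b b' -> moment a b = moment a b'.
Proof. by move=> bb'; apply: eq_measure_integral => A mA _; exact: bb'. Qed.

Lemma sqnormD_le (x y : 'rV[R]_d) : (sqnorm (x + y)%R <= 2 * sqnorm x + 2 * sqnorm y)%R.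
Proof.
rewrite /sqnorm !mulr_sumr -big_split/=; apply: ler_sum => i _; rewrite mxE.
rewrite -subr_ge0; have -> : (2 * x ord0 i ^+ 2 + 2 * y ord0 i ^+ 2 -
  (x ord0 i + y ord0 i) ^+ 2 = (x ord0 i - y ord0 i) ^+ 2)%R by ring.
exact: sqr_ge0.
Qed.

Lemma coupling_moment1 a b b' (p : probability (X * X)%type R) : coupling b b' p ->
  \int[p]_xy (sqnorm ((xy.1 : 'rV[R]_d) - a)%R)%:E = moment a b.
Proof.
move=> [h _]; rewrite -(moment_eq_proba _ h) /moment.
rewrite ge0_integral_marginal1//; first by apply/measurable_EFinP; exact: measurable_sqnorm_sub.
by move=> x; rewrite lee_fin sqnorm_ge0.
Qed.

Lemma coupling_moment2 a b b' (p : probability (X * X)%type R) : coupling b b' p ->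
  \int[p]_xy (sqnorm ((xy.2 : 'rV[R]_d) - a)%R)%:E = moment a b'.
Proof.
move=> [_ h]; rewrite -(moment_eq_proba _ h) /moment.
rewrite ge0_integral_marginal2//; first by apply/measurable_EFinP; exact: measurable_sqnorm_sub.
by move=> x; rewrite lee_fin sqnorm_ge0.
Qed.

Lemma measurable_sub1 a : measurable_fun [set: X * X] (fun xy => sqnorm ((xy.1 : 'rV[R]_d) - a)%R).
Proof. exact: (@measurable_sqnormB _ _ _ (X * X)%type fst (cst (a : X)) measurable_fst). Qed.

Lemma measurable_sub2 a : measurable_fun [set: X * X] (fun xy => sqnorm ((xy.2 : 'rV[R]_d) - a)%R).
Proof. exact: (@measurable_sqnormB _ _ _ (X * X)%type snd (cst (a : X)) measurable_snd). Qed.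

(** Integrates |x - a|^2 <= 2 |x - y|^2 + 2 |y - a|^2 against an optimal coupling; it transfers
    finiteness of second moments. *)
Lemma moment_le_W2sq a b b' : moment a b <= 2%:E * W2sq b b' + 2%:E * moment a b'.
Proof.
have [->|Woo] := eqVneq (W2sq b b') +oo.
  rewrite gt0_muley ?lte_fin// addye ?leey//.
  by rewrite -ltNye (lt_le_trans (ltNyr 0%R))// mule_ge0// moment_ge0.
have [|p pc <-] := @W2sq_attained _ _ b b'; first by rewrite ltey.
rewrite -(coupling_moment1 a pc) -(coupling_moment2 a pc).
rewrite -ge0_integral_comb//; last first.
- exact: measurable_sub2.
- exact: measurable_cost.
- by move=> xy; exact: sqnorm_ge0.
- by move=> xy; exact: cost_ge0.
apply: ge0_le_integral => //.
- by move=> xy _; rewrite lee_fin sqnorm_ge0.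
- by apply/measurable_EFinP; exact: measurable_sub1.
- apply/measurable_EFinP; apply: measurable_funD; apply: measurable_funM => //.
  + exact: measurable_cost.
  + exact: measurable_sub2.
move=> xy _; rewrite lee_fin -(subrKA (xy.2 : 'rV[R]_d)).
exact: sqnormD_le.
Qed.

Lemma moment_le_moment a a' b : moment a b <= 2%:E * moment a' b + (2 * sqnorm (a' - a)%R)%:E.
Proof.
rewrite -[X in _ + X](integral_cst_proba b) /moment.
rewrite -ge0_integralZl//; first last.
- by move=> x _; rewrite lee_fin sqnorm_ge0.
- by apply/measurable_EFinP; exact: measurable_sqnorm_sub.
rewrite -ge0_integralD//; first last.
- by move=> x _; rewrite lee_fin mulr_ge0// sqnorm_ge0.
- by apply/measurable_EFinP; apply: measurable_funM => //; exact: measurable_sqnorm_sub.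
- by move=> x _; rewrite -EFinM lee_fin mulr_ge0// sqnorm_ge0.
apply: ge0_le_integral => //.
- by move=> x _; rewrite lee_fin sqnorm_ge0.
- by apply/measurable_EFinP; exact: measurable_sqnorm_sub.
- by apply: emeasurable_funD => //; apply/measurable_EFinP; apply: measurable_funM => //; exact: measurable_sqnorm_sub.
move=> x _; rewrite -EFinM -EFinD lee_fin -(subrKA a').
exact: sqnormD_le.
Qed.

Lemma moment_fin a a' b : moment a' b < +oo -> moment a b < +oo.
Proof.
move=> h; apply: le_lt_trans (moment_le_moment a a' b) _.
have -> : moment a' b = (fine (moment a' b))%:E by rewrite fineK// ge0_fin_numE// moment_ge0.
by rewrite -EFinM -EFinD ltry.
Qed.

Definition homothety a (c : R) (x : X) : X := (a + c *: ((x : 'rV[R]_d) - a))%R.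

Lemma measurable_homothety a c : measurable_fun [set: X] (homothety a c).
Proof.
apply: measurable_fun_coord => i; rewrite /homothety.
under eq_fun do rewrite !mxE.
apply: measurable_funD => //; apply: measurable_funM => //; apply: measurable_funB => //.
exact: measurable_coord.
Qed.

HB.instance Definition _ a c :=
  isMeasurableFun.Build _ _ _ _ (homothety a c) (measurable_homothety a c).

Definition dilate a c b : probability X R := distribution b (homothety a c).

Lemma dilate_coupling a c b b' p : coupling b b' p ->
  exists2 p', coupling b (dilate a c b') p' &
    \int[p']_xy (cost xy)%:E = \int[p]_xy (cost (xy.1, homothety a c xy.2))%:E.
Proof.
move=> [h1 h2].
have mg : measurable_fun [set: X * X] (fun xy : X * X => (xy.1, homothety a c xy.2)).
  apply/measurable_fun_pairP; split; first exact: measurable_fst.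
  by apply: (measurableT_comp (@measurable_homothety a c)); exact: measurable_snd.
pose g : {mfun (X * X)%type >-> (X * X)%type} :=
  HB.pack (fun xy : X * X => (xy.1, homothety a c xy.2)) (isMeasurableFun.Build _ _ _ _ _ mg).
exists (distribution p g).
  split => A mA; first exact: h1.
  have mA' : measurable (homothety a c @^-1` A).
    by rewrite -[X in measurable X]setTI; exact: measurable_homothety.
  exact: (h2 _ mA').
rewrite ge0_integral_distribution//=; first by apply/measurable_EFinP; exact: measurable_cost.
by move=> xy; rewrite lee_fin cost_ge0.
Qed.

(** With u = x - a and v = y - a, this is (u - c v)^2 = (1 - c) u^2 + c (u - v)^2 + c (c - 1) v^2:
    the cross term is absorbed by the cost itself, so the coupling enters only through its cost and
    its marginals. *)
Let sqr_homothety (a x y c : R) :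
  ((x - (a + c * (y - a))) ^+ 2 + (c - 1) * (x - a) ^+ 2 =
   c * (x - y) ^+ 2 + c * (c - 1) * (y - a) ^+ 2)%R.
Proof. by ring. Qed.

Lemma cost_homothety a c (xy : X * X) :
  (cost (xy.1, homothety a c xy.2) + (c - 1) * sqnorm ((xy.1 : 'rV[R]_d) - a) =
   c * cost xy + c * (c - 1) * sqnorm ((xy.2 : 'rV[R]_d) - a))%R.
Proof.
rewrite /cost/= !sqnormB !mulr_sumr -!big_split/=; apply: eq_bigr => i _.
by rewrite !mxE sqr_homothety.
Qed.

(* Any coupling of [b] and [b'] has its cost changed by the same affine function
   when [b'] is dilated about [a]; this and the next lemma are the cases [c >= 1]
   and [c <= 1] of one identity, arranged so that no term is subtracted. *)
Lemma W2sq_dilate_ge1 a c b b' : (1 <= c)%R ->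
  W2sq b (dilate a c b') + (c - 1)%:E * moment a b <=
  c%:E * W2sq b b' + (c * (c - 1))%:E * moment a b'.
Proof.
move=> c1; have c0 : (0 < c)%R by exact: lt_le_trans c1.
have cc0 : (0 <= c * (c - 1))%R by rewrite mulr_ge0 ?subr_ge0// ltW.
have [->|Woo] := eqVneq (W2sq b b') +oo.
  rewrite gt0_muley ?lte_fin// addye ?leey//.
  by rewrite -ltNye (lt_le_trans (ltNyr 0%R))// mule_ge0// moment_ge0.
have [|p pc <-] := @W2sq_attained _ _ b b'; first by rewrite ltey.
have [p' pc' p'E] := dilate_coupling a c pc.
apply: le_trans (leeD2r _ (W2sq_le pc')) _; rewrite p'E.
rewrite -(coupling_moment1 a pc) -(coupling_moment2 a pc).
have mh : measurable_fun [set: X * X] (fun xy => cost (xy.1, homothety a c xy.2)).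
  apply: (@measurable_sqnormB _ _ _ (X * X)%type fst (homothety a c \o snd)).
    exact: measurable_fst.
  by apply: measurableT_comp; [exact: measurable_homothety|exact: measurable_snd].
rewrite -[X in X + _]mul1e -!ge0_integral_comb ?subr_ge0 ?(ltW c0)//;
  try (by move=> xy; exact: sqnorm_ge0);
  try exact: measurable_cost; try exact: measurable_sub1; try exact: measurable_sub2.
by rewrite le_eqVlt; apply/orP; left; apply/eqP; apply: eq_integral => xy _; rewrite mul1r cost_homothety.
Qed.

Lemma W2sq_dilate_le1 a c b b' : (0 < c <= 1)%R ->
  W2sq b (dilate a c b') + (c * (1 - c))%:E * moment a b' <=
  c%:E * W2sq b b' + (1 - c)%:E * moment a b.
Proof.
move=> /andP[c0 c1].
have cc0 : (0 <= c * (1 - c))%R by rewrite mulr_ge0 ?subr_ge0// ltW.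
have [->|Woo] := eqVneq (W2sq b b') +oo.
  rewrite gt0_muley ?lte_fin// addye ?leey//.
  by rewrite -ltNye (lt_le_trans (ltNyr 0%R))// mule_ge0 ?moment_ge0// lee_fin subr_ge0.
have [|p pc <-] := @W2sq_attained _ _ b b'; first by rewrite ltey.
have [p' pc' p'E] := dilate_coupling a c pc.
apply: le_trans (leeD2r _ (W2sq_le pc')) _; rewrite p'E.
rewrite -(coupling_moment1 a pc) -(coupling_moment2 a pc).
have mh : measurable_fun [set: X * X] (fun xy => cost (xy.1, homothety a c xy.2)).
  apply: (@measurable_sqnormB _ _ _ (X * X)%type fst (homothety a c \o snd)).
    exact: measurable_fst.
  by apply: measurableT_comp; [exact: measurable_homothety|exact: measurable_snd].
rewrite -[X in X + _]mul1e -!ge0_integral_comb ?subr_ge0 ?(ltW c0)//;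
  try (by move=> xy; exact: sqnorm_ge0);
  try exact: measurable_cost; try exact: measurable_sub1; try exact: measurable_sub2.
rewrite le_eqVlt; apply/orP; left; apply/eqP; apply: eq_integral => xy _; congr EFin.
by have := cost_homothety a c xy; lra.
Qed.

(** A coupling with the Dirac mass at x is concentrated on pairs whose first component is x, so all
    couplings have the same cost. *)
Lemma W2sq_dirac (x : X) b :
  W2sq (dirac x) b = \int[b]_y (sqnorm ((x : 'rV[R]_d) - y)%R)%:E.
Proof.
have mf : measurable_fun [set: X] (fun y : X => sqnorm ((x : 'rV[R]_d) - (y : 'rV[R]_d))%R).
  exact: (@measurable_sqnormB _ _ _ X (cst x) id).
have m1 : measurable [set x].
  rewrite -[X in measurable X]setCK; apply: measurableC; apply: sub_sigma_algebra.
  by rewrite openC; apply: accessible_closed_set1; apply: hausdorff_accessible; exact: norm_hausdorff.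
have mg : measurable_fun [set: X] (fun y : X => (x, y)) by exact: measurable_pair1.
pose g : {mfun X >-> (X * X)%type} := HB.pack (fun y : X => (x, y)) (isMeasurableFun.Build _ _ _ _ _ mg).
apply/eqP; rewrite eq_le; apply/andP; split.
  have pc : coupling (dirac x) b (distribution b g).
    split => A mA //=; rewrite /marginal1 /distribution /pushforward /= diracE.
    have [/set_mem xA|/negP xA] := boolP (x \in A).
      rewrite (_ : _ @^-1` _ = setT); first exact: probability_setT.
      by apply/seteqP; split.
    rewrite (_ : _ @^-1` _ = set0); first exact: measure0.
    by apply/seteqP; split => // y /= /mem_set.
  apply: le_trans (W2sq_le pc) _.
  by rewrite ge0_integral_distribution//=; [apply/measurable_EFinP; exact: measurable_cost|move=> xy; rewrite lee_fin cost_ge0].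
apply: le_ereal_inf_tmp => _ [p [h1 h2] <-].
have mf2 : measurable_fun [set: X * X] (fun xy : X * X => sqnorm ((x : 'rV[R]_d) - (xy.2 : 'rV[R]_d))%R).
  exact: (@measurable_sqnormB _ _ _ (X * X)%type (cst x) snd).
rewrite -(eq_measure_integral _ (fun A mA _ => h2 A mA)).
rewrite ge0_integral_marginal2//; first last.
- by move=> y; rewrite lee_fin sqnorm_ge0.
- exact/measurable_EFinP.
rewrite le_eqVlt; apply/orP; left; apply/eqP; apply: ge0_ae_eq_integral => //.
- exact/measurable_EFinP.
- by apply/measurable_EFinP; exact: measurable_cost.
- by move=> xy _; rewrite lee_fin sqnorm_ge0.
- by move=> xy _; rewrite lee_fin cost_ge0.
exists (fst @^-1` (~` [set x])); split.
- by rewrite -[X in measurable X]setTI; apply: measurable_fst => //; exact: measurableC.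
- apply: (etrans (h1 _ (measurableC m1))).
  by rewrite /= diracE memNset//=; apply.
- by move=> xy /= h E; apply: h => _; rewrite /cost E.
Qed.

End moments.

(** * Variance *)

Lemma integral_sqr_sub (R : realType) dT (T : measurableType dT) (m : probability T R)
    (f : T -> R) (a : R) :
  measurable_fun [set: T] f -> \int[m]_t (f t ^+ 2)%:E < +oo ->
  \int[m]_t ((f t - a) ^+ 2)%:E =
  (fine (\int[m]_t (f t ^+ 2)%:E) - 2 * a * fine (\int[m]_t (f t)%:E) + a ^+ 2)%:E.
Proof.
move=> mf f2.
have mf2 : measurable_fun [set: T] (fun t => (f t ^+ 2)%:E).
  by apply/measurable_EFinP; exact: measurable_funX.
have int2 : m.-integrable [set: T] (fun t => (f t ^+ 2)%:E).
  apply/integrableP; split => //.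
  by under eq_integral do rewrite gee0_abs ?lee_fin ?sqr_ge0//.
have intc (c : R) : m.-integrable [set: T] (fun t => c%:E).
  exact: finite_measure_integrable_cst.
have int1 : m.-integrable [set: T] (fun t => (f t)%:E).
  (* Integrability of [f] follows from |f| <= f^2 + 1, the measure being finite. *)
  apply: (le_integrable measurableT (g := fun t => (f t ^+ 2)%:E + 1%:E)) => //.
  - exact/measurable_EFinP.
  - move=> t _; rewrite -EFinD !abse_EFin lee_fin.
    rewrite [leRHS]ger0_norm ?addr_ge0 ?sqr_ge0// -[X in (_ <= X + _)%R]real_normK ?num_real//.
    by have := sqr_ge0 (`|f t| - 1)%R; have := normr_ge0 (f t); nra.
  - exact: integrableD.
have int1c : m.-integrable [set: T] (fun t => (- (2 * a))%:E * (f t)%:E).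
  exact: integrableZl.
have -> : \int[m]_t ((f t - a) ^+ 2)%:E =
    \int[m]_t ((f t ^+ 2)%:E + ((- (2 * a))%:E * (f t)%:E + (a ^+ 2)%:E)).
  by apply: eq_integral => t _; rewrite -EFinM -!EFinD; congr EFin; ring.
rewrite integralD//; last exact: integrableD.
rewrite integralD// integralZl// integral_cst_proba.
rewrite -{1}(fineK (integrable_fin_num measurableT int2)) -{1}(fineK (integrable_fin_num measurableT int1)).
by rewrite -EFinM -!EFinD; congr EFin; ring.
Qed.

Section variance.
Context (R : realType) (d : nat).
Local Notation X := (Rd R d).
Implicit Types (a : 'rV[R]_d) (b : probability X R).

Lemma moment0 b : moment 0%R b = \int[b]_x (sqnorm x)%:E.
Proof. by apply: eq_integral => x _; rewrite subr0. Qed.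

(** The Huygens-Steiner identity, obtained coordinate by coordinate. *)
Lemma moment_mean a b : moment 0%R b < +oo ->
  moment a b = moment (mean b) b + (sqnorm (mean b - a)%R)%:E.
Proof.
move=> b2.
have mc i : measurable_fun [set: X] (fun x : X => (x : 'rV[R]_d) ord0 i) by exact: measurable_coord.
have sumE a' : moment a' b = \sum_(i < d) \int[b]_x (((x : 'rV[R]_d) ord0 i - a' ord0 i) ^+ 2)%:E.
  rewrite /moment -ge0_integral_sum//.
  - by apply: eq_integral => x _; rewrite sqnormB sumEFin.
  - by move=> i; apply/measurable_EFinP; apply: measurable_funX; exact: measurable_funB.
  - by move=> i x _; rewrite lee_fin sqr_ge0.
have fin i : \int[b]_x ((x : 'rV[R]_d) ord0 i ^+ 2)%:E < +oo.
  apply: le_lt_trans b2; rewrite moment0; apply: ge0_le_integral => //.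
  - by move=> x _; rewrite lee_fin sqr_ge0.
  - by apply/measurable_EFinP; exact: measurable_funX.
  - have := @measurable_sqnorm_sub R d 0%R => /measurable_EFinP.
    by under eq_fun do rewrite subr0.
  - move=> x _; rewrite lee_fin /sqnorm (bigD1 i)//= lerDl.
    by apply: sumr_ge0 => j _; exact: sqr_ge0.
rewrite !sumE; under eq_bigr do rewrite integral_sqr_sub//.
under [in RHS]eq_bigr do rewrite integral_sqr_sub//.
rewrite sqnormB !sumEFin -EFinD; congr EFin; rewrite -big_split/=.
by apply: eq_bigr => i _; rewrite /mean !mxE /Rintegral; ring.
Qed.

Lemma VarE b : moment 0%R b < +oo -> Var b = moment (mean b) b.
Proof. by move=> h; rewrite /Var -moment0 h. Qed.

Lemma Var_pinfty b : moment 0%R b = +oo -> Var b = +oo.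
Proof. by move=> h; rewrite /Var -moment0 h ltxx. Qed.

Lemma Var_ge0 b : 0 <= Var b.
Proof. by rewrite /Var; case: ifP => // _; exact: moment_ge0. Qed.

Lemma Var_le_moment a b : Var b <= moment a b.
Proof.
have [h|] := ltP (moment 0%R b) +oo.
  by rewrite VarE// (moment_mean a)// leeDl// lee_fin sqnorm_ge0.
rewrite leye_eq => /eqP h; rewrite (_ : moment a b = +oo) ?leey//.
apply/eqP; rewrite -leye_eq leNgt; apply/negP => /(moment_fin 0%R).
by rewrite h.
Qed.

End variance.

(** * The variance decomposition *)

Lemma ge0_integral_lin (R : realType) dT (T : measurableType dT)
    (m : {measure set T -> \bar R}) (f g : T -> \bar R) (u v : R) :
  (0 <= u)%R -> (0 <= v)%R -> (forall t, 0 <= f t) -> (forall t, 0 <= g t) ->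
  measurable_fun [set: T] f -> measurable_fun [set: T] g ->
  \int[m]_t (u%:E * f t + v%:E * g t) = u%:E * \int[m]_t f t + v%:E * \int[m]_t g t.
Proof.
move=> u0 v0 f0 g0 mf mg.
rewrite ge0_integralD//.
- by rewrite !ge0_integralZl.
- by move=> t _; rewrite mule_ge0.
- exact: measurable_funeM.
- by move=> t _; rewrite mule_ge0.
- exact: measurable_funeM.
Qed.

Section disintegration.
Context (R : realType) (d : nat) dZ (Z : measurableType dZ).
Local Notation X := (Rd R d).
Context (rho : probability (X * Z)%type R) (k : Z -> pprobability X R).
Hypothesis rho_k : disintegration rho k.
Let nu := marginal2 rho.

Let mk : measurable_fun [set: Z] k. Proof. exact: rho_k.1. Qed.

Let kg (z : Z) : giry X R := k z.

Let mkg : measurable_fun [set: Z] kg.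
Proof.
apply: measurable_giry_codensity => // B mB.
exact: (measurable_kernel (kprobability mk) B mB).
Qed.

(** The first marginal is the Giry bind of [nu] with [k]: both give a set [A] the integral of
    [k z A]. *)
Lemma ge0_integral_disintegration (f : X -> \bar R) :
  measurable_fun [set: X] f -> (forall x, 0 <= f x) ->
  \int[marginal1 rho]_x f x = \int[nu]_z \int[k z]_x f x.
Proof.
move=> mf f0.
have := @giry_int_bind _ _ _ _ R (nu : giry Z R) kg mkg f mf f0; rewrite /giry_int => <-.
apply: eq_measure_integral => A mA _.
rewrite /giry_bind/= giry_int_map//; [|exact: measurable_giry_ev].
rewrite /giry_int /= -(rho_k.2 A [set: Z] mA measurableT).
rewrite /marginal1 /distribution /pushforward/=; congr (rho _).
by apply/seteqP; split => -[x z] //= [].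
Qed.

Lemma measurable_moment a : measurable_fun [set: Z] (fun z => moment a (k z)).
Proof.
apply: (measurableT_comp (@measurable_giry_int _ X R _ _ _) mkg).
- by apply/measurable_EFinP; exact: measurable_sqnorm_sub.
- by move=> x; rewrite lee_fin sqnorm_ge0.
Qed.

Lemma moment_marginal1 a : moment a (marginal1 rho) = \int[nu]_z moment a (k z).
Proof.
rewrite /moment ge0_integral_disintegration//.
- by apply/measurable_EFinP; exact: measurable_sqnorm_sub.
- by move=> x; rewrite lee_fin sqnorm_ge0.
Qed.

Let F b := \int[nu]_z W2sq (k z) b.

Let F_ge0 b : 0 <= F b.
Proof. by apply: integral_ge0 => z _; exact: W2sq_ge0. Qed.

Let mW b : measurable_fun [set: Z] (fun z => W2sq (k z) b).
Proof. exact: measurable_W2sq. Qed.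

Let W0 b z : 0 <= W2sq (k z) b. Proof. exact: W2sq_ge0. Qed.

(** When the cost is finite, a finite second moment passes from [b] to the marginal; the next lemma
    passes it back. *)
Lemma moment_marginal1_le a b :
  moment a (marginal1 rho) <= 2%:E * F b + 2%:E * moment a b.
Proof.
rewrite moment_marginal1 -[X in _ + _ * X](integral_cst_proba nu).
rewrite -ge0_integral_lin//; last by move=> _; exact: moment_ge0.
apply: ge0_le_integral => //.
- by move=> z _; exact: moment_ge0.
- exact: measurable_moment.
- by apply: emeasurable_funD => //; exact: measurable_funeM.
- by move=> z _; exact: moment_le_W2sq.
Qed.

Lemma moment_barycenter_le a b :
  moment a b <= 2%:E * F b + 2%:E * moment a (marginal1 rho).
Proof.
rewrite moment_marginal1 -[leLHS](integral_cst_proba nu).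
rewrite -ge0_integral_lin//; [|by move=> z; exact: moment_ge0|exact: measurable_moment].
apply: ge0_le_integral => //.
- by move=> z _; exact: moment_ge0.
- apply: emeasurable_funD => //; apply: measurable_funeM => //; exact: measurable_moment.
- by move=> z _; rewrite W2sqC; exact: moment_le_W2sq.
Qed.

Lemma integral_W2sq_dirac a : F (dirac (a : X)) = moment a (marginal1 rho).
Proof.
rewrite moment_marginal1; apply: eq_integral => z _.
rewrite W2sqC W2sq_dirac; apply: eq_integral => x _.
by rewrite sqnormBC.
Qed.

(* Minimality of the barycenter against its dilations about [a], at first order
   on both sides of [c = 1]. *)
Lemma barycenter_moment a b : barycenter nu k b -> moment 0%R (marginal1 rho) < +oo ->
  moment a (marginal1 rho) = moment a b + F b.
Proof.
move=> bar rho2.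
have F_le b' : F b <= F b'.
  by rewrite /F bar; apply: ereal_inf_lbound; exists b'.
have rhoa := moment_fin a rho2.
have Foo : F b < +oo.
  by apply: le_lt_trans (F_le (dirac (0%R : X))) _; rewrite integral_W2sq_dirac.
have finE (x : \bar R) : 0 <= x -> x < +oo -> x = (fine x)%:E.
  by move=> x0 xoo; rewrite fineK// ge0_fin_numE.
have FE := finE _ (F_ge0 b) Foo.
have rhoE := finE _ (moment_ge0 a _) rhoa.
have boo : moment a b < +oo.
  apply: le_lt_trans (moment_barycenter_le a b) _.
  by rewrite FE rhoE -!EFinM -EFinD ltry.
have bE := finE _ (moment_ge0 a _) boo.
have r0 := moment_ge0 a (marginal1 rho); have s0 := moment_ge0 a b.
have ge1 c : (1 <= c)%R -> F b + (c - 1)%:E * moment a (marginal1 rho) <=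
    c%:E * F b + (c * (c - 1))%:E * moment a b.
  move=> c1; have c0 : (0 <= c)%R by exact: le_trans c1.
  have cc0 : (0 <= c * (c - 1))%R by rewrite mulr_ge0 ?subr_ge0.
  apply: le_trans (leeD2r _ (F_le (dilate a c b))) _.
  (* The moment of [b] is written as the integral of a constant over [nu], so that the inequality
     reduces to [W2sq_dilate_ge1] for each z. *)
  rewrite moment_marginal1 -[X in _ <= _ + _ * X](integral_cst_proba nu).
  rewrite -[X in X + _ <= _]mul1e -!ge0_integral_lin ?subr_ge0//;
    try (by move=> *; exact: moment_ge0); try exact: measurable_moment.
  apply: ge0_le_integral => //.
  - by move=> z _; rewrite adde_ge0// mule_ge0// ?moment_ge0// lee_fin subr_ge0.
  - by apply: emeasurable_funD => //; apply: measurable_funeM => //; exact: measurable_moment.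
  - by apply: emeasurable_funD => //; exact: measurable_funeM.
  - by move=> z _; rewrite mul1e; exact: W2sq_dilate_ge1.
have le1 c : (0 < c <= 1)%R -> F b + (c * (1 - c))%:E * moment a b <=
    c%:E * F b + (1 - c)%:E * moment a (marginal1 rho).
  move=> /andP[c0 c1].
  have cc0 : (0 <= c * (1 - c))%R by rewrite mulr_ge0 ?subr_ge0// ltW.
  apply: le_trans (leeD2r _ (F_le (dilate a c b))) _.
  rewrite moment_marginal1 -[X in _ + _ * X <= _](integral_cst_proba nu).
  rewrite -[X in X + _ <= _]mul1e -!ge0_integral_lin ?subr_ge0 ?(ltW c0)//;
    try (by move=> *; exact: moment_ge0); try exact: measurable_moment.
  apply: ge0_le_integral => //.
  - by move=> z _; rewrite adde_ge0// mule_ge0// ?moment_ge0.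
  - by apply: emeasurable_funD => //; exact: measurable_funeM.
  - by apply: emeasurable_funD => //; apply: measurable_funeM => //; exact: measurable_moment.
  - by move=> z _; rewrite mul1e; apply: W2sq_dilate_le1; rewrite c0.
move: r0 s0 ge1 le1; rewrite FE rhoE bE !lee_fin.
move: (fine (F b)) (fine (moment a (marginal1 rho))) (fine (moment a b)) => f r s r0 s0 ge1 le1.
rewrite -EFinD; congr EFin; apply/eqP; rewrite eq_le; apply/andP; split; rewrite leNgt; apply/negP => h.
(* At c = 1 + e, dividing by e leaves r <= f + (1 + e) s. This [e] makes e s < r - s - f, a
   contradiction; the added 1 keeps the denominator positive when s = 0. *)
- pose e := ((r - s - f) / (2 * (s + 1)))%R.
  have s1 : (0 < 2 * (s + 1))%R by lra.
  have e0 : (0 < e)%R by rewrite divr_gt0//; lra.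
  have eE : (e * (2 * (s + 1)) = r - s - f)%R by rewrite mulfVK// gt_eqF.
  have := ge1 (1 + e)%R ltac:(by lra); rewrite -!EFinM -!EFinD lee_fin.
  have -> : (1 + e - 1 = e)%R by ring.
  move=> h1; have : (e * r <= e * (f + (1 + e) * s))%R by lra.
  by rewrite ler_pM2l//; nra.
(* At c = 1 - e, dividing by e leaves f + (1 - e) s <= r. The gap s + f - r also enters the
   denominator in order to keep e below 1. *)
- pose e := ((s + f - r) / (2 * (s + 1 + (s + f - r))))%R.
  have s1 : (0 < 2 * (s + 1 + (s + f - r)))%R by lra.
  have e0 : (0 < e)%R by rewrite divr_gt0//; lra.
  have eE : (e * (2 * (s + 1 + (s + f - r))) = s + f - r)%R by rewrite mulfVK// gt_eqF.
  have e1 : (e < 1)%R by rewrite ltr_pdivrMr//; lra.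
  have := le1 (1 - e)%R ltac:(by apply/andP; split; lra); rewrite -!EFinM -!EFinD lee_fin.
  have -> : (1 - (1 - e) = e)%R by ring.
  move=> h1; have : (e * (f + (1 - e) * s) <= e * r)%R by lra.
  by rewrite ler_pM2l//; nra.
Qed.

Lemma barycenter_Var : exists b, barycenter nu k b /\ Var (marginal1 rho) = Var b + F b.
Proof.
pose C := ereal_inf [set F b | b in [set: probability X R]].
have Var_neqNy b : Var b != -oo by rewrite -ltNye (lt_le_trans (ltNyr 0%R))// Var_ge0.
have [rho2|] := ltP (moment 0%R (marginal1 rho)) +oo.
  have [|b bar] := @barycenter_exists _ _ _ _ nu k mk.
    apply: le_lt_trans (_ : F (dirac (0%R : X)) < _).
      by apply: ereal_inf_lbound; exists (dirac (0%R : X)).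
    by rewrite integral_W2sq_dirac.
  exists b; split => //; apply/eqP; rewrite eq_le; apply/andP; split.
    (* The two inequalities come from two centres: the mean of [b] here, the mean of the marginal in
       the other direction. *)
    have E := barycenter_moment (mean b) bar rho2.
    have b2 : moment 0%R b < +oo.
      apply: le_lt_trans (rho2); rewrite (barycenter_moment 0%R bar rho2).
      by rewrite leeDl.
    by rewrite (VarE b2) -E; exact: Var_le_moment.
  rewrite (VarE rho2) (barycenter_moment _ bar rho2).
  by apply: leeD => //; exact: Var_le_moment.
rewrite leye_eq => /eqP rho2; rewrite (Var_pinfty rho2).
(* The right-hand side must now be infinite. A barycenter with finite second moment has infinite
   cost by [moment_marginal1_le]; and if the infimum itself is infinite, the Dirac mass at 0 is
   already a barycenter. *)
have [Coo|] := ltP C +oo.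
  have [b bar] := barycenter_exists mk Coo.
  exists b; split => //.
  have [b2|] := ltP (moment 0%R b) +oo; last first.
    rewrite leye_eq => /eqP b2; rewrite (Var_pinfty b2) addye//.
    by rewrite -ltNye (lt_le_trans (ltNyr 0%R)).
  suff -> : F b = +oo by rewrite addey ?Var_neqNy.
  apply/eqP; rewrite -leye_eq leNgt; apply/negP => Fb.
  have := moment_marginal1_le 0%R b; rewrite rho2 leye_eq => /eqP.
  have -> : F b = (fine (F b))%:E by rewrite fineK// ge0_fin_numE.
  have -> : moment 0%R b = (fine (moment 0%R b))%:E by rewrite fineK// ge0_fin_numE// moment_ge0.
  by rewrite -!EFinM -EFinD.
rewrite leye_eq => /eqP Coo; exists (dirac (0%R : X)).
have FE : F (dirac (0%R : X)) = +oo.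
  apply/eqP; rewrite -leye_eq -Coo; apply: ereal_inf_lbound.
  by exists (dirac (0%R : X)).
split; first by rewrite /barycenter -/(F _) FE -Coo.
by rewrite FE addey ?Var_neqNy.
Qed.

End disintegration.

(** * Dirac kernels and the characterization of the variance *)

Section diagonal.
Context (R : realType) (d : nat).
Local Notation X := (Rd R d).
Context (eta : probability X R).

Let diag (x : X) : X * X := (x, x).

Let measurable_diag : measurable_fun [set: X] diag.
Proof. by apply/measurable_fun_pairP; split; exact: measurable_id. Qed.

HB.instance Definition _ := isMeasurableFun.Build _ _ _ _ diag measurable_diag.

Definition diagonal : probability (X * X)%type R := distribution eta diag.

Definition dirac_kernel (x : X) : pprobability X R := dirac x.

Lemma measurable_dirac_kernel : measurable_fun [set: X] dirac_kernel.
Proof.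
apply: (@measurability _ _ X (pprobability X R) setT dirac_kernel (@pset _ X R)) => // _ [_ [r r01] [U mU <-]] <-.
rewrite setTI.
have := @measurable_fun_dirac _ X R setT U mU measurableT _ (emeasurable_itv `]-oo, r%:E[).
by rewrite setTI.
Qed.

Lemma disintegration_diagonal : disintegration diagonal dirac_kernel.
Proof.
split; first exact: measurable_dirac_kernel.
move=> A B mA mB; rewrite /= integral_indic//.
Qed.

Lemma integral_diagonal2 (f : X -> \bar R) :
  \int[marginal2 diagonal]_x f x = \int[eta]_x f x.
Proof. exact: eq_measure_integral. Qed.

(** By Tonelli's theorem the cost is an average, over [b], of the moments of [eta] about y, which
    [moment_mean] makes explicit. *)
Lemma integral_W2sq_dirac_kernel b :
  \int[marginal2 diagonal]_z W2sq (dirac_kernel z) b = \int[b]_y moment y eta.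
Proof.
rewrite integral_diagonal2.
under eq_integral do rewrite W2sq_dirac.
have mf : measurable_fun [set: X * X] (fun xy : X * X => (cost xy)%:E).
  by apply/measurable_EFinP; exact: measurable_cost.
have f0 (xy : X * X) : 0 <= (cost xy)%:E by rewrite lee_fin cost_ge0.
exact: (fubini_tonelli _ mf f0).
Qed.

End diagonal.

Lemma sqnorm_eq0 (R : realType) (d : nat) (x : 'rV[R]_d) : sqnorm x = 0%R -> x = 0%R.
Proof.
move=> /eqP; rewrite psumr_eq0 => [/allP h|i _]; last exact: sqr_ge0.
apply/rowP => i; rewrite mxE; apply/eqP; rewrite -sqrf_eq0.
by apply: (implyP (h i _)) => //; rewrite mem_index_enum.
Qed.

Lemma moment_eq0 (R : realType) (d : nat) (a : 'rV[R]_d) (b : probability (Rd R d) R) :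
  moment a b = 0 -> eq_proba b (dirac (a : Rd R d)).
Proof.
move=> h.
have mf : measurable_fun [set: Rd R d] (fun x : Rd R d => (sqnorm ((x : 'rV[R]_d) - a)%R)%:E).
  by apply/measurable_EFinP; exact: measurable_sqnorm_sub.
have [N [mN N0 hN]] : ae_eq b setT (fun x : Rd R d => (sqnorm ((x : 'rV[R]_d) - a)%R)%:E) (cst 0).
  apply/(ae_eq_integral_abs _ measurableT mf).
  by under eq_integral do rewrite gee0_abs ?lee_fin ?sqnorm_ge0//.
have b0 (A : set (Rd R d)) : measurable A -> ~ A a -> b A = 0.
  move=> mA Aa; apply/eqP; rewrite eq_le measure_ge0 andbT -N0.
  apply: le_measure; rewrite ?inE// => x Ax; apply: hN => /= /(_ Logic.I) [] /sqnorm_eq0 /eqP.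
  by rewrite subr_eq0 => /eqP xa; apply: Aa; rewrite -xa.
move=> A mA; rewrite /= diracE; have [/set_mem Aa|/negP Aa] := boolP ((a : Rd R d) \in A).
  rewrite -[A]setCK probability_setC; last exact: measurableC.
  by rewrite b0 ?sube0//; exact: measurableC.
by rewrite b0// => /mem_set.
Qed.

Theorem corollary4 (R : realType) (d : nat)
    (V : probability (Rd R d) R -> \bar R)
    (V_well_defined : well_defined V)
    (V_gt_ninfty : forall eta, V eta != -oo)
    (V_dirac : forall x : Rd R d, V (dirac x) = 0) :
  V = @Var R d <->
  (forall (dZ : measure_display) (Z : measurableType dZ)
      (rho : probability (Rd R d * Z)%type R)
      (k : Z -> pprobability (Rd R d) R),
    disintegration rho k ->
    exists mu : probability (Rd R d) R,
      barycenter (marginal2 rho) k mu /\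
      V (marginal1 rho) = V mu + \int[marginal2 rho]_z W2sq (k z) mu).
Proof.
split=> [-> dZ Z rho k rho_k|h]; first exact: barycenter_Var.
apply/funext => eta.
have [mu [bar]] := h _ _ _ _ (disintegration_diagonal eta).
rewrite (V_well_defined (marginal1 (diagonal eta)) eta)//.
move: bar; rewrite /barycenter integral_W2sq_dirac_kernel => bar ->.
have [eta2|] := ltP (moment 0%R eta) +oo; last first.
  (* Every moment of [eta] is infinite, whatever its centre, so the cost is infinite; as [V mu] is
     not -oo, the sum is +oo. *)
  rewrite leye_eq => /eqP eta2; rewrite (Var_pinfty eta2).
  rewrite (eq_integral (cst +oo)); first by rewrite integral_cst_proba addey.
  move=> y _; apply/eqP; rewrite -leye_eq leNgt; apply/negP => /(moment_fin 0%R).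
  by rewrite eta2.
pose m := mean eta.
have momE (b : probability (Rd R d) R) : \int[b]_y moment y eta = Var eta + moment m b.
  under eq_integral do rewrite moment_mean// -VarE// sqnormBC.
  rewrite ge0_integralD//.
  - by rewrite integral_cst_proba.
  - by move=> y _; exact: Var_ge0.
  - by move=> y _; rewrite lee_fin sqnorm_ge0.
  - by apply/measurable_EFinP; exact: measurable_sqnorm_sub.
have VarE : Var eta = (fine (Var eta))%:E.
  by rewrite fineK// ge0_fin_numE ?Var_ge0// (VarE eta2) (moment_fin _ eta2).
have m0 : moment m (dirac (m : Rd R d)) = 0.
  rewrite /moment integral_dirac//.
    by rewrite diracT mul1e subrr /sqnorm big1// => i _; rewrite mxE expr0n.
  by apply/measurable_EFinP; exact: measurable_sqnorm_sub.
have mu0 : moment m mu = 0.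
  apply/eqP; rewrite eq_le moment_ge0 andbT.
  (* Comparison with the Dirac mass at the mean; [Var eta] is finite here and can be cancelled. Only
     agreement with that Dirac mass on measurable sets results, hence the final appeal to
     [V_well_defined]. *)
  have : Var eta + moment m mu <= Var eta + moment m (dirac (m : Rd R d)).
    rewrite -!momE bar; apply: ereal_inf_lbound; exists (dirac (m : Rd R d)) => //.
    exact: integral_W2sq_dirac_kernel.
  by rewrite m0 VarE leeD2lE.
by rewrite (V_well_defined _ _ (moment_eq0 mu0)) V_dirac momE mu0 adde0 add0e.
Qed.
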